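(* Let $\mu$ be a non-negative Radon measure on $\mathbb{R}^n$ (not necessarily doubling) with $0<\mu(Q)<\infty$ for all $Q\in\mathcal{Q}$, such that $\mu(L)=0$ for any hyperplane $L$ orthogonal to one of the coordinate axes. Let $0<p<\infty$, $v,w\in A_\infty(\mathcal{Q},\mu)$, and let $f$ be a measurable complex-valued function on $\mathbb{R}^n$. Then $f$ is in $L^1_{loc}(\mu_v)$ and satisfies $$\sup_{Q\in\mathcal{Q}}\Big(\frac1{\mu_w(Q)}\int_Q|f(x)-f_{\mu_v,Q}|^p\,d\mu_w(x)\Big)^{1/p}<\infty$$ if and only if $f$ is in $BMO_\mu(\mathbb{R}^n)$. In such a case, $$\|f\|_{BMO_\mu(\mathbb{R}^n)}\approx\sup_{Q\in\mathcal{Q}}\Big(\frac1{\mu_w(Q)}\int_Q|f(x)-f_{\mu_v,Q}|^p\,d\mu_w(x)\Big)^{1/p},$$ with implicit constants independent of $f$.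
   Context: $\mathcal{Q}$ is the collection of all cubes in $\mathbb{R}^n$ with sides parallel to the axes. For $1<p<\infty$, $A_p(\mathcal{Q},\mu)$ is the set of non-negative locally $\mu$-integrable $w$ with $\sup_{Q\in\mathcal{Q}}\big(\frac1{\mu(Q)}\int_Q w\,d\mu\big)\big(\frac1{\mu(Q)}\int_Q w^{-p'/p}\,d\mu\big)^{p/p'}<\infty$, $p'=p/(p-1)$, and $A_\infty(\mathcal{Q},\mu)=\bigcup_{1<p<\infty}A_p(\mathcal{Q},\mu)$. For $w\in A_\infty(\mathcal{Q},\mu)$, $d\mu_w=w\,d\mu$, so $\mu_w(Q)=\int_Qw\,d\mu$. For a measure $\nu$, $L^1_{loc}(\nu)$ is the set of measurable functions $\nu$-integrable on every cube, and $f_{\nu,Q}=\frac1{\nu(Q)}\int_Qf\,d\nu$. $BMO_\mu(\mathbb{R}^n)$ is the set of $f\in L^1_{loc}(\mu)$ with $\|f\|_{BMO_\mu(\mathbb{R}^n)}=\sup_{Q\in\mathcal{Q}}\frac1{\mu(Q)}\int_Q|f(x)-f_{\mu,Q}|\,d\mu(x)<\infty$. $A\approx B$ means that each quantity is bounded by a constant multiple of the other. *)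

(* Defs.v *)
From HB Require Import structures.
From mathcomp Require Import all_boot all_order all_algebra.
From mathcomp Require Import all_classical all_reals all_analysis.
From mathcomp Require Export complex.

Set Implicit Arguments.
Unset Strict Implicit.
Unset Printing Implicit Defensive.

Import Order.TTheory GRing.Theory Num.Theory.
Import numFieldNormedType.Exports.

Local Open Scope classical_set_scope.
Local Open Scope ring_scope.

Notation borelRn R n := (g_sigma_algebraType (@open 'rV[R]_n)).

(* The measure argument of the definitions below is a plain set function, so
   that they apply verbatim to the weighted measures [wmeasure mu w]; see
   also the type of [integral] in MathComp-Analysis. *)
Section Definitions.
Context (R : realType) (n : nat).
Local Notation T := (borelRn R n).
Implicit Types (mu nu : set T -> \bar R) (f : T -> R[i]).

Definition radon_measure mu : Prop :=
  [/\ (forall K : set 'rV[R]_n, compact K -> (mu K < +oo)%E),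
      (forall A : set T, measurable A ->
        mu A = ereal_inf [set mu U | U in
                 [set U : set 'rV[R]_n | open U /\ A `<=` U]]) &
      (forall U : set 'rV[R]_n, open U ->
        mu U = ereal_sup [set mu K | K in
                 [set K : set 'rV[R]_n | compact K /\ K `<=` U]])].

Definition cube (a : 'rV[R]_n) (l : R) : set T :=
  [set x : 'rV[R]_n | forall i, a ord0 i <= x ord0 i <= a ord0 i + l].

(* Closed cubes; under the hypothesis that coordinate hyperplanes are null,
   the choice of closed, open or half-open cubes is immaterial. *)
Definition cubes : set (set T) :=
  [set Q | exists (a : 'rV[R]_n) (l : R), 0 < l /\ Q = cube a l].

Definition coord_hyperplane (i : 'I_n) (c : R) : set T :=
  [set x : 'rV[R]_n | x ord0 i = c].

Definition conj_exp (p : R) : R := p / (p - 1).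

(* [Ap_dual p w] is w ^ (- p' / p), with value +oo where w vanishes:
   MathComp-Analysis has 0^-1 = +oo in [\bar R], but 0 `^ r = 0 for r < 0. *)
Definition Ap_dual (p : R) (w : T -> R) (x : T) : \bar R :=
  (((w x)%:E^-1) `^ (conj_exp p / p))%E.

Definition average nu (Q : set T) (g : T -> \bar R) : \bar R :=
  ((nu Q)^-1 * \int[nu]_(x in Q) g x)%E.

(* The finiteness of the integrals of [Ap_dual p w] only excludes the weights
   vanishing mu-almost everywhere, for which the product in the A_p condition
   is 0 * +oo, i.e. 0 in MathComp-Analysis: for any other w it follows from
   the last condition. *)
Definition Ap mu (p : R) : set (T -> R) :=
  [set w : T -> R | [/\ (forall x, 0 <= w x),
    measurable_fun setT w /\
      (forall Q, cubes Q -> mu.-integrable Q (EFin \o w)),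
    (forall Q, cubes Q -> (\int[mu]_(x in Q) Ap_dual p w x < +oo)%E) &
    (ereal_sup [set average mu Q (EFin \o w) *
                    (average mu Q (Ap_dual p w)) `^ (p / conj_exp p)
               | Q in cubes] < +oo)%E]].

Definition Ainfty mu : set (T -> R) :=
  \bigcup_(p in [set p : R | 1 < p]) Ap mu p.

Definition wmeasure mu (w : T -> R) : set T -> \bar R :=
  fun A => (\int[mu]_(x in A) (w x)%:E)%E.

Definition cmeasurable f : Prop :=
  measurable_fun setT (fun x => complex.Re (f x)) /\
  measurable_fun setT (fun x => complex.Im (f x)).

Definition cabs (z : R[i]) : R := ComplexField.Normc.normc z.

Definition L1loc nu : set (T -> R[i]) :=
  [set f | cmeasurable f /\
    forall Q, cubes Q -> (\int[nu]_(x in Q) (cabs (f x))%:E < +oo)%E].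

Definition cintegral nu (Q : set T) f : R[i] :=
  Complex (fine (\int[nu]_(x in Q) (complex.Re (f x))%:E)%E)
          (fine (\int[nu]_(x in Q) (complex.Im (f x))%:E)%E).

Definition cmean nu (Q : set T) f : R[i] :=
  (((fine (nu Q))^-1)%:C)%C * cintegral nu Q f.

Definition BMO_norm mu f : \bar R :=
  ereal_sup [set average mu Q (fun x => (cabs (f x - cmean mu Q f))%:E)
            | Q in cubes].

Definition BMO mu : set (T -> R[i]) :=
  [set f | L1loc mu f /\ (BMO_norm mu f < +oo)%E].

Definition wosc (p : R) mu (v w : T -> R) f : \bar R :=
  ereal_sup [set ((average (wmeasure mu w) Q
      (fun x => ((cabs (f x - cmean (wmeasure mu v) Q f)) `^ p)%:E)) `^ p^-1)%E
            | Q in cubes].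

End Definitions.

(* Main.v *)
Require Import Defs.
From HB Require Import structures.
From mathcomp Require Import all_boot all_order all_algebra.
From mathcomp Require Import all_classical all_reals all_analysis.
From mathcomp Require Import measurable_realfun ring lra zify.

(** Everything passes through a condition of John-Stromberg type,
    [approx_by mu f A c]: in every cube [Q], at most a quarter of the
    [mu]-mass lies where [f] is farther than [A] from the constant [c Q].

    All that is used of an [A_infty] weight is [comparable_measure]: a subset
    carrying a quarter of the [mu]-mass of a cube carries a fixed proportion of
    its weighted mass.  It follows from the [A_p] condition by the Chebyshev
    inequality for the dual weight ([comparable_Ainfty]).  With it, a bound on
    the p-th mean of [|f - c Q|] for one weight gives [approx_by], again by
    Chebyshev ([Lp_bound_approx]).  Conversely [approx_by] bounds all p-th
    means for all weights ([approx_Lp_bound]), hence allows [c Q] to be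
    replaced by the mean of [f] for any weight ([approx_cmean]).  The [BMO]
    norm and the weighted oscillation are both comparable with the best [A],
    and the theorem follows by going around this circle once in each direction.

    The hard implication is [approx_Lp_bound], which rests on the geometric
    decay of the sets [E t] of the points of [Q] where [|f - c Q| > t]
    ([decay_step]).  Around almost every point of [E (t + 2 A)] there is a
    cube [Q'] inside [Q] exactly half filled by [E (t + 2 A)]: small cubes are
    filled by density, [Q] itself is not, and the mass of a growing cube varies
    continuously as coordinate hyperplanes are null.  On three quarters of [Q']
    the function is within [A] of [c Q']; this part meets [E (t + 2 A)], so
    [|c Q' - c Q| > t + A], and therefore it lies in [E t].  Hence a quarter of
    [Q'] lies in [E t] minus [E (t + 2 A)].  As [mu] need not be doubling, these
    cubes are combined by a covering of Besicovitch type, with overlap bounded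
    in terms of the dimension; being of bounded overlap, it can be summed
    against the weighted measure itself, which gives
    [nu (E (t + 2 A)) <= C * nu (E t `\` E (t + 2 A))] and the decay of [nu]
    directly.

    The covering cubes must stay inside [Q], so [subcube a l x t] is the cube of
    side [t] centred at [x] and then pushed back into [cube a l]. *)

Set Implicit Arguments.
Unset Strict Implicit.
Unset Printing Implicit Defensive.

Import Order.TTheory GRing.Theory Num.Theory.
Import numFieldNormedType.Exports.

Local Open Scope classical_set_scope.
Local Open Scope ring_scope.

(** * Cubes pushed inside a given cube *)
Section Corner.
Context {R : realType}.
Implicit Types a l x y z s t : R.

(** Left end of the interval of length [t] inside [a, a + l] whose centre is as
    close to [x] as possible. *)
Definition corner a l x t : R := Num.max a (Num.min (a + l - t) (x - t / 2)).

(** The pushing status of the interval: against the left end, against the right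
    end, or not pushed. *)
Variant corner_spec a l x t : R -> bool -> bool -> Prop :=
  | CornerLow of x - t / 2 < a : corner_spec a l x t a true false
  | CornerHigh of a + l - t < x - t / 2 & a <= a + l - t :
      corner_spec a l x t (a + l - t) false true
  | CornerMid of a <= x - t / 2 & x - t / 2 <= a + l - t :
      corner_spec a l x t (x - t / 2) false false.

Lemma cornerP a l x t : a <= x <= a + l -> t <= l ->
  corner_spec a l x t (corner a l x t) (x - t / 2 < a) (a + l - t < x - t / 2).
Proof.
move=> /andP[ax xl] tl; rewrite /corner.
have [h1|] := boolP (x - t / 2 < a).
  have h2 : (a + l - t < x - t / 2) = false by apply/negbTE; rewrite -leNgt; lra.
  by rewrite h2 min_r ?max_l; [constructor|lra..].
rewrite -leNgt => h1; have [h2|] := boolP (a + l - t < x - t / 2).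
  by rewrite min_l ?max_r; [constructor; lra|lra..].
by rewrite -leNgt => h2; rewrite min_r ?max_r; [constructor|lra..].
Qed.

Lemma corner_top a l x : a <= x <= a + l -> corner a l x l = a.
Proof. by move=> axl; case: cornerP => //=; lra. Qed.

Lemma corner_nonincr a l x s t : s <= t -> corner a l x t <= corner a l x s.
Proof.
move=> st; rewrite /corner ge_max le_max lexx /= le_max; apply/orP; right.
by rewrite le_min !ge_min; apply/andP; split; apply/orP; [left|right]; lra.
Qed.

(** Together with [corner_nonincr]: the right end [corner a l x t + t] moves
    monotonically with [t], and both ends move at speed at most one. *)
Lemma corner_lipschitz a l x s t : s <= t ->
  corner a l x s <= corner a l x t + (t - s).
Proof.
move=> st; rewrite /corner ge_max; apply/andP; split.
  rewrite -lerBlDr le_max; apply/orP; left; lra.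
rewrite -lerBlDr le_max; apply/orP; right.
rewrite le_min; apply/andP; split; rewrite lerBlDr ge_min; apply/orP;
  [left|right]; lra.
Qed.

Lemma corner_near a l x t y : a <= x <= a + l -> 0 <= t <= l ->
  a <= y <= a + l -> `|y - x| <= t / 2 ->
  corner a l x t <= y <= corner a l x t + t.
Proof.
move=> axl /andP[t0 tl] /andP[ay yl]; rewrite ler_norml => /andP[h1 h2].
by case: cornerP => //=; lra.
Qed.

Lemma corner_close a l x t y : 0 <= t <= l -> a <= x <= a + l ->
  corner a l x t <= y <= corner a l x t + t -> `|y - x| <= t.
Proof.
move=> /andP[t0 tl] axl /andP[h1 h2]; rewrite ler_norml.
by move: h1 h2; case: cornerP => //=; lra.
Qed.

(** One coordinate of the Besicovitch argument: if two intervals with the same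
    pushing status share [z] and their base points lie on the same side of [z],
    then the longer one contains the base point of the other.  Without the
    hypothesis on the status this fails: an interval pushed against an end may
    reach [z] by more than half of its length. *)
Lemma corner_conflict a l x y s t z : 0 < t -> t <= s -> s <= l ->
  a <= x <= a + l -> a <= y <= a + l ->
  (x - s / 2 < a) = (y - t / 2 < a) ->
  (a + l - s < x - s / 2) = (a + l - t < y - t / 2) ->
  (z <= x) = (z <= y) ->
  corner a l x s <= z <= corner a l x s + s ->
  corner a l y t <= z <= corner a l y t + t ->
  corner a l x s <= y <= corner a l x s + s.
Proof.
move=> t0 ts sl axl ayl; have tl : t <= l by lra.
case: (cornerP axl sl) => [?|? ?|? ?]; case: (cornerP ayl tl) => [?|? ?|? ?] // _ _;
  case: (leP z x) => ?; case: (leP z y) => ? // _; lra.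
Qed.

End Corner.

(** * A covering of Besicovitch type *)

(** Number of colours: in each coordinate, the two bits of the pushing status,
    the side of the common point, and the grid cell modulo 16. *)
Definition overlap_bound (n : nat) : nat :=
  #|{: {ffun 'I_n -> bool * bool * bool * 'I_16}}|.

Section Covering.
Context {R : realType} {n : nat}.
Local Notation T := (borelRn R n).
Local Notation V := 'rV[R]_n.
Implicit Types (a x y z : V) (l t s : R).

Definition subcube a l x t : set T :=
  cube (\row_i corner (a ord0 i) l (x ord0 i) t) t.

Lemma in_subcube a l x t z : subcube a l x t z <->
  forall i, corner (a ord0 i) l (x ord0 i) t <= z ord0 i
            <= corner (a ord0 i) l (x ord0 i) t + t.
Proof. by split=> h i; have := h i; rewrite mxE. Qed.

Lemma subcube_top a l x : cube a l x -> subcube a l x l = cube a l.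
Proof.
move=> ax; apply/seteqP; split=> z.
  by move/in_subcube => h i; have := h i; rewrite corner_top.
by move=> h; apply/in_subcube => i; rewrite corner_top.
Qed.

Lemma subcube_sub a l x s t : s <= t -> subcube a l x s `<=` subcube a l x t.
Proof.
move=> st z /in_subcube h; apply/in_subcube => i.
move: (h i) (corner_nonincr (a ord0 i) l (x ord0 i) st)
  (corner_lipschitz (a ord0 i) l (x ord0 i) st) => /andP[]; lra.
Qed.

Lemma subcube_subcube a l x t : cube a l x -> t <= l ->
  subcube a l x t `<=` cube a l.
Proof. by move=> ax tl; rewrite -(subcube_top ax); exact: subcube_sub. Qed.

Lemma subcube_cubes a l x t : 0 < t -> cubes (subcube a l x t).
Proof. by move=> t0; exists (\row_i corner (a ord0 i) l (x ord0 i) t), t. Qed.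

Lemma in_subcube_near a l x t y : cube a l x -> 0 <= t <= l -> cube a l y ->
  (forall i, `|y ord0 i - x ord0 i| <= t / 2) -> subcube a l x t y.
Proof.
move=> ax tl ay h; apply/in_subcube => i; exact: corner_near.
Qed.

(** Dyadic generations: distinct generations have strictly ordered sides, so
    the Besicovitch argument between them needs no loss in the radii. *)
Lemma generation_exists l t : 0 < t <= l ->
  exists k : nat, l / 2 ^+ k.+1 < t <= l / 2 ^+ k.
Proof.
move=> /andP[t0 tl].
have ex : exists k : nat, l / 2 ^+ k.+1 < t.
  exists (Num.bound (l / t)); rewrite ltr_pdivrMr ?exprn_gt0//.
  rewrite -ltr_pdivrMl// mulrC.
  apply: (@lt_trans _ _ (Num.bound (l / t))%:R).
    by apply: archi_boundP; rewrite divr_ge0//; lra.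
  rewrite -natrX ltr_nat; apply: (@ltn_trans (2 ^ Num.bound (l / t))).
    exact: ltn_expl.
  by rewrite ltn_exp2l.
exists (ex_minn ex); case: ex_minnP => k -> kmin /=.
case: k kmin => [_|k kmin]; first by rewrite expr0 divr1.
by rewrite leNgt; apply/negP => /kmin; rewrite ltnn.
Qed.

Definition grid_cell (h : R) x : {ffun 'I_n -> int} :=
  [ffun i => Num.floor (x ord0 i / h)].

Lemma grid_cell_near h x y : 0 < h -> grid_cell h x = grid_cell h y ->
  forall i, `|y ord0 i - x ord0 i| <= h.
Proof.
move=> h0 /ffunP xy i; have := xy i; rewrite !ffunE => e.
have /andP[] := floor_itv (x ord0 i / h).
have /andP[] := floor_itv (y ord0 i / h).
rewrite e !intrD; set f := (_ %:~R) => h1 h2 h3 h4.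
rewrite -[leRHS]mul1r -ler_pdivrMr// -{1}[h]gtr0_norm// -normf_div mulrBl.
rewrite ler_norml; lra.
Qed.

(** The modulus 16 separates cells whose points are at distance at most 8 mesh
    sizes, which bounds the distance of two base points of the same generation
    whose cubes meet. *)
Lemma grid_cell_mod h x y : 0 < h ->
  (forall i, `|y ord0 i - x ord0 i| <= 8 * h) ->
  (forall i, (grid_cell h x i = grid_cell h y i %[mod 16])%Z) ->
  grid_cell h x = grid_cell h y.
Proof.
move=> h0 d e; apply/ffunP => i; have /eqP := e i; have := d i.
rewrite eqz_mod_dvd !ffunE => {}d /dvdzP[q qE].
have /andP[a1 a2] := floor_itv (x ord0 i / h).
have /andP[a3 a4] := floor_itv (y ord0 i / h).
move: a1 a2 a3 a4 qE; set f := Num.floor _; set g := Num.floor _.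
rewrite !intrD => a1 a2 a3 a4 qE.
move: d; rewrite -ler_pdivrMr// -{1}[h]gtr0_norm// -normf_div mulrBl.
rewrite ler_norml => /andP[b1 b2].
have c1 : (f - g)%:~R < (16%:~R : R) by rewrite rmorphB/=; lra.
have c2 : (-16)%:~R < ((f - g)%:~R : R) by rewrite rmorphB/= rmorphN/=; lra.
move: c1 c2; rewrite !ltr_int; lia.
Qed.

(** The selection proceeds by generations [k], in which the side [r x] is in
    the interval from [l / 2 ^ k.+1] to [l / 2 ^ k].  Among the points of
    generation [k] not yet covered, one is chosen in each cell of a grid of mesh
    [l / 2 ^ k.+2]; since the mesh is less than half of the side, its cube
    covers all the others of its cell.  Two selected cubes sharing a point [z] have
    different colours: for distinct generations by [corner_conflict], as the
    later base point is not covered; within a generation because equal colours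
    force equal cells. *)
Section Selection.
Variables (a : V) (l : R) (A : set V) (r : V -> R).
Hypotheses (l0 : 0 < l) (Aa : A `<=` cube a l).
Hypothesis (r0 : forall x, A x -> 0 < r x <= l).

Let side k := l / 2 ^+ k.
Let mesh k := side k.+2.
Let gen k : set V := [set x | A x /\ side k.+1 < r x <= side k].
Let cell k := grid_cell (mesh k).
Let eligible k (U : set V) c := [set x | gen k x /\ ~ U x /\ cell k x = c].
Let chosen k U c : V := xget 0 (eligible k U c).
Let box k (U : set V) c : set T :=
  if `[< eligible k U c !=set0 >]
  then subcube a l (chosen k U c) (r (chosen k U c)) else set0.

Fixpoint covered k : set V :=
  if k is j.+1 then covered j `|` \bigcup_c box j (covered j) c else set0.

Let decode (m : nat) : option (nat * {ffun 'I_n -> int}) := pickle_inv m.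

Let decodeK m kc : decode m = Some kc -> pickle kc = m.
Proof. by rewrite /decode /pickle_inv; case: unpickle => //= x; case: eqP => // <- [->]. Qed.

Definition selected (m : nat) : set T :=
  if decode m is Some (k, c) then box k (covered k) c else set0.

Let side_gt0 k : 0 < side k.
Proof. by rewrite divr_gt0// exprn_gt0. Qed.

Let sideS k : side k.+1 = side k / 2.
Proof. by rewrite /side exprS invfM mulrCA mulrC. Qed.

Let side_le j k : (j <= k)%N -> side k <= side j.
Proof. by move=> jk; rewrite ler_pM2l// lef_pV2 ?posrE ?exprn_gt0// ler_eXn2l//; lra. Qed.

Lemma boxP k U c z : box k U c z -> eligible k U c (chosen k U c) /\
  box k U c = subcube a l (chosen k U c) (r (chosen k U c)).
Proof. by rewrite /box; case: asboolP => // -[x] /(@xgetI _ 0). Qed.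

Lemma selectedP m : selected m = set0 \/
  exists2 x, A x & selected m = subcube a l x (r x).
Proof.
have [->|/set0P[z]] := eqVneq (selected m) set0; first by left.
rewrite /selected; case: decode => [[k c]|//].
by move=> /boxP[[[Ax _] _] ->]; right; exists (chosen k (covered k) c).
Qed.

Lemma covered_mono j k : (j <= k)%N -> covered j `<=` covered k.
Proof.
by move=> /subnKC <-; elim: (k - j)%N => [|i IH]; rewrite ?addn0// addnS => x /IH; left.
Qed.

Lemma selected_cover : A `<=` \bigcup_m selected m.
Proof.
have covS k : covered k `<=` \bigcup_m selected m.
  elim: k => [//|k IH] x /= [/IH//|[c _ xc]].
  by exists (pickle (k, c)) => //; rewrite /selected /decode pickleK_inv.
move=> x Ax; have [k /andP[k1 k2]] := generation_exists (r0 Ax).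
apply: (covS k.+1) => /=.
have [?|xc] := pselect (covered k x); [by left|right].
exists (cell k x) => //; rewrite /box.
have el : eligible k (covered k) (cell k x) x by split => //; split => //; rewrite k1.
case: asboolP => [_|]; last by case; exists x.
have := @xgetI _ 0 (eligible k (covered k) (cell k x)) _ el.
rewrite -/(chosen _ _ _); set y := chosen _ _ _ => -[[Ay /andP[y1 y2]] [_ yx]].
apply: in_subcube_near.
- exact: Aa.
- by have := r0 Ay; lra.
- exact: Aa.
- move=> i; apply: le_trans (grid_cell_near _ yx i) _; first exact: side_gt0.
  by rewrite /mesh sideS; lra.
Qed.

Let colour z (kc : nat * {ffun 'I_n -> int}) :
    {ffun 'I_n -> bool * bool * bool * 'I_16} :=
  let x := chosen kc.1 (covered kc.1) kc.2 in
  [ffun i => (x ord0 i - r x / 2 < a ord0 i,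
              a ord0 i + l - r x < x ord0 i - r x / 2,
              z ord0 i <= x ord0 i,
              inord `|(kc.2 i %% 16)%Z|)].

Let colour_lt z k c j d : (k < j)%N -> colour z (k, c) = colour z (j, d) ->
  box k (covered k) c z -> box j (covered j) d z -> False.
Proof.
move=> kj /ffunP e; move=> kz /[dup] /boxP[[[Ay /andP[_ y2]] [Uy _]] ->] jz.
apply: Uy; apply: (covered_mono kj); right; exists c => //.
have [[[Ax /andP[x1 _]] _] xE] := boxP kz; rewrite xE.
move: kz; rewrite xE => /in_subcube kz; move/in_subcube : jz => jz.
have yx := le_trans y2 (side_le kj); apply/in_subcube => i.
have := e i; rewrite !ffunE/= => -[e1 e2 e3 _].
apply: (corner_conflict _ _ _ _ _ e1 e2 e3 (kz i) (jz i)).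
- by have /andP[] := r0 Ay.
- by have := le_lt_trans yx x1; exact: ltW.
- by have /andP[] := r0 Ax.
- exact: Aa.
- exact: Aa.
Qed.

Let colour_inj z m1 m2 kc1 kc2 :
  decode m1 = Some kc1 -> decode m2 = Some kc2 ->
  selected m1 z -> selected m2 z -> colour z kc1 = colour z kc2 -> m1 = m2.
Proof.
rewrite /selected => E1 E2; rewrite E1 E2.
rewrite -(decodeK E1) -(decodeK E2).
case: kc1 kc2 {E1 E2} => [k c] [j d] kz jz e; congr (pickle _).
case: (ltngtP k j) => [kj|jk|kj].
- by case: (colour_lt kj e kz jz).
- by case: (colour_lt jk (esym e) jz kz).
rewrite -{}kj in jz e *; congr pair.
have [[[Ax /andP[_ x2]] [_ xc]] xE] := boxP kz.
have [[[Ay /andP[_ y2]] [_ yd]] yE] := boxP jz.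
rewrite xE in kz; rewrite yE in jz.
suff xy : cell k (chosen k (covered k) c) = cell k (chosen k (covered k) d).
  by rewrite -xc xy yd.
apply: grid_cell_mod => [|i|i]; first exact: side_gt0.
  have hx := @corner_close _ (a ord0 i) l _ _ _ _ _ ((in_subcube _ _ _ _ _).1 kz i).
  have hy := @corner_close _ (a ord0 i) l _ _ _ _ _ ((in_subcube _ _ _ _ _).1 jz i).
  have /andP[rx0 rxl] := r0 Ax; have /andP[ry0 ryl] := r0 Ay.
  have {}hx := hx (andb_true_intro (conj (ltW rx0) rxl)) (Aa Ax i).
  have {}hy := hy (andb_true_intro (conj (ltW ry0) ryl)) (Aa Ay i).
  move: hx hy; rewrite /mesh !sideS !ler_norml; lra.
rewrite -[grid_cell _ _]/(cell k _) xc -[grid_cell _ _]/(cell k _) yd.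
have /ffunP/(_ i) := e; rewrite !ffunE/= => -[_ _ _] /(congr1 val)/=.
rewrite !inordK; lia.
Qed.

Lemma selected_overlap z N :
  (#|[pred m : 'I_N | `[< selected m z >]]| <= overlap_bound n)%N.
Proof.
pose f (m : 'I_N) := colour z (odflt (0%N, [ffun=> 0]) (decode m)).
suff injf : {in [pred m : 'I_N | `[< selected m z >]] &, injective f}.
  by rewrite -(card_in_image injf) max_card.
move=> m1 m2; rewrite !inE => s1 s2; rewrite /f => e.
apply/val_inj => /=.
case E1 : (decode (m1 : nat)) e s1 => [kc1|]; last by rewrite /selected E1.
case E2 : (decode (m2 : nat)) s2 => [kc2|]; last by rewrite /selected E2.
by move=> s2 e s1; exact: (colour_inj E1 E2 s1 s2 e).
Qed.

End Selection.
End Covering.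

Section CoveringEstimate.
Context {R : realType} {n : nat}.
Local Notation T := (borelRn R n).
Local Notation V := 'rV[R]_n.
Implicit Types (a x y z : V) (l t s : R).

Lemma subcube_covering a l (A : set V) (r : V -> R) : 0 < l ->
  A `<=` cube a l -> (forall x, A x -> 0 < r x <= l) ->
  exists Q : (set T)^nat,
  [/\ forall m, Q m = set0 \/ exists2 x, A x & Q m = subcube a l x (r x),
      A `<=` \bigcup_m Q m &
      forall z N, (#|[pred m : 'I_N | `[< Q m z >]]| <= overlap_bound n)%N].
Proof.
move=> l0 Aa r0; exists (selected a l A r); split.
- exact: selectedP.
- exact: selected_cover.
- exact: selected_overlap.
Qed.

Lemma measurable_open_borel (U : set V) : open U -> measurable (U : set T).
Proof. by move=> oU; apply: sub_sigma_algebra. Qed.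

Lemma open_coord_lt (i : 'I_n) (c : R) : open [set x : V | x ord0 i < c].
Proof.
apply: (@open_comp _ _ (fun x : V => x ord0 i) [set y | y < c]).
  by move=> x _; exact: coord_continuous.
exact: open_lt.
Qed.

Lemma open_coord_gt (i : 'I_n) (c : R) : open [set x : V | c < x ord0 i].
Proof.
apply: (@open_comp _ _ (fun x : V => x ord0 i) [set y | c < y]).
  by move=> x _; exact: coord_continuous.
exact: open_gt.
Qed.

Lemma measurable_cube a l : measurable (cube a l : set T).
Proof.
suff oC : open (~` (cube a l : set V)).
  by rewrite -[cube a l]setCK; exact: measurableC (measurable_open_borel oC).
rewrite (_ : ~` _ = \bigcup_i ([set x : V | x ord0 i < a ord0 i] `|`
                               [set x : V | a ord0 i + l < x ord0 i])).
  apply: bigcup_open => i _; apply: openU; [exact: open_coord_lt|exact: open_coord_gt].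
apply/seteqP; split=> x /=.
  move=> h; apply: contrapT => h'; apply: h => i; rewrite !leNgt.
  by apply/andP; split; apply/negP => ?; apply: h'; exists i => //; [left|right].
by move=> [i _ [] /= h] /(_ i) /andP[]; rewrite !leNgt h.
Qed.

Lemma measurable_cubes (Q : set T) : cubes Q -> measurable Q.
Proof. by move=> [a [l [_ ->]]]; exact: measurable_cube. Qed.

Lemma measurable_hyperplane (i : 'I_n) (c : R) :
  measurable (coord_hyperplane i c : set T).
Proof.
suff oC : open (~` (coord_hyperplane i c : set V)).
  by rewrite -[coord_hyperplane i c]setCK; exact: measurableC (measurable_open_borel oC).
rewrite (_ : ~` _ = [set x : V | x ord0 i < c] `|` [set x : V | c < x ord0 i]).
  by apply: openU; [exact: open_coord_lt|exact: open_coord_gt].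
apply/seteqP; split=> x /=; rewrite /coord_hyperplane/=.
  by move/eqP; rewrite neq_lt => /orP[]; [left|right].
by move=> [] h; apply/eqP; rewrite neq_lt h ?orbT.
Qed.

(** Summing over a subfamily of bounded overlap: if each cube [subcube a l x (r x)]
    has a fixed proportion of its mass in [F], then the set of base points has
    mass at most a constant times that of [F].  [A] need not be measurable,
    whence the measurable hull [G]. *)
Lemma covering_estimate (nu : {measure set T -> \bar R}) a l (A : set V)
    (r : V -> R) (F : set T) (K : R) : 0 < l -> 0 <= K ->
  A `<=` cube a l -> (forall x, A x -> 0 < r x <= l) -> measurable F ->
  (forall x, A x -> (nu (subcube a l x (r x)) <=
                     K%:E * nu (subcube a l x (r x) `&` F))%E) ->
  exists G : set T, [/\ measurable G, A `<=` G &
    (nu G <= (K * (overlap_bound n)%:R)%:E * nu F)%E].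
Proof.
move=> l0 K0 Aa r0 mF h.
have [Q [QP AQ Qo]] := subcube_covering l0 Aa r0.
have mQ m : measurable (Q m).
  by case: (QP m) => [->|[x _ ->]] //; exact: measurable_cube.
have QK m : (nu (Q m) <= K%:E * nu (Q m `&` F))%E.
  case: (QP m) => [->|[x Ax ->]]; last exact: h.
  by rewrite measure0 mule_ge0.
exists (\bigcup_m Q m); split => //; first exact: bigcup_measurable.
apply: (@le_trans _ _ (\sum_(m <oo) nu (Q m))%E).
  by apply: measure_sigma_subadditive => //; exact: bigcup_measurable.
apply: lime_le; first exact: is_cvg_nneseries.
apply: nearW => N.
apply: (@le_trans _ _ (\sum_(0 <= m < N) K%:E * nu (Q m `&` F))%E).
  exact: lee_sum.
rewrite -ge0_sume_distrr// EFinM -muleA lee_wpmul2l ?lee_fin//.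
have -> : (\sum_(0 <= m < N) nu (Q m `&` F) =
          \int[nu]_(x in F) \sum_(0 <= m < N) (\1_(Q m) x)%:E)%E.
  rewrite ge0_integral_sum//.
    by apply: eq_bigr => m _; rewrite integral_indic.
  by move=> m; apply/measurable_EFinP; exact: measurable_indic.
apply: (@le_trans _ _ (\int[nu]_(x in F) (cst (overlap_bound n)%:R%:E x))%E); last first.
  by rewrite integral_cst.
apply: ge0_le_integral => //.
- by move=> x _; apply: sume_ge0 => m _; rewrite lee_fin.
- by apply: emeasurable_sum => m; apply/measurable_EFinP; exact: measurable_indic.
move=> x _ /=; rewrite sumEFin lee_fin.
apply: le_trans (_ : #|[pred m : 'I_N | `[< Q m x >]]|%:R <= _); last by rewrite ler_nat.
rewrite big_mkord -sum1_card natr_sum [leRHS]big_mkcond/=.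
apply: ler_sum => m _; rewrite inE indicE.
by case: asboolP => q; [rewrite mem_set|rewrite memNset].
Qed.

End CoveringEstimate.

(** * Half-filled cubes *)

Section BalancedCubes.
Context {R : realType} {n : nat}.
Local Notation T := (borelRn R n).
Local Notation V := 'rV[R]_n.
Implicit Types (a x y z : V) (l t s : R).
Variable mu : {measure set T -> \bar R}.
Hypothesis cube_mass : forall Q : set T, cubes Q -> (0 < mu Q < +oo)%E.

Lemma fin_num_subset (A Q : set T) : cubes Q -> measurable A -> A `<=` Q ->
  mu A \is a fin_num.
Proof.
move=> cQ mA AQ; rewrite ge0_fin_numE//.
apply: (@le_lt_trans _ _ (mu Q)); last by have /andP[] := cube_mass cQ.
by apply: le_measure => //; rewrite inE//; exact: measurable_cubes.
Qed.

Lemma fin_num_subcube a l x t (F : set T) : measurable F ->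
  mu (subcube a l x t `&` F) \is a fin_num.
Proof.
move=> mF; have t1 : 0 < Num.max t 1 by rewrite lt_max ltr01 orbT.
apply: (fin_num_subset (subcube_cubes a l x t1)).
  by apply: measurableI => //; exact: measurable_cube.
by move=> y [/(@subcube_sub _ _ _ _ _ _ (Num.max t 1)) + _]; apply; rewrite le_max lexx.
Qed.

Hypothesis hyperplane_null : forall (i : 'I_n) (c : R),
  mu (coord_hyperplane i c) = 0%E.

(* The faces of [subcube a l x t], indexed by nat for [negligible_bigcup]. *)
Let faces a l x t : set T := \bigcup_k
  oapp (fun i : 'I_n => coord_hyperplane i (corner (a ord0 i) l (x ord0 i) t) `|`
                coord_hyperplane i (corner (a ord0 i) l (x ord0 i) t + t))
       set0 (insub k).

Let faces_null a l x t : mu.-negligible (faces a l x t).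
Proof.
apply: negligible_bigcup => k; case: insub => [i|] /=; last exact: negligible_set0.
by apply: negligibleU; apply/negligibleP; try exact: measurable_hyperplane; exact: hyperplane_null.
Qed.

Let shell a l x t (d : R) : set T := subcube a l x (t + d) `\` subcube a l x (t - d).

(* A point off the faces is strictly inside or strictly outside the closed cube,
   and stays so under small changes of the side. *)
Let shell_faces a l x t :
  \bigcap_k shell a l x t k.+1%:R^-1 `<=` faces a l x t.
Proof.
move=> y h; apply: contrapT => yf.
pose c i := corner (a ord0 i) l (x ord0 i) t.
have yc i : y ord0 i != c i /\ y ord0 i != c i + t.
  by split; apply/eqP => e; apply: yf; exists (val i) => //=; rewrite valK /=; [left|right].
have small (e : R) : 0 < e -> \forall k \near \oo, k.+1%:R^-1 < e.
  by move=> e0; have := near_infty_natSinv_lt (PosNum e0).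
have [[i /negP]|inside] := pselect (exists i, ~ (c i <= y ord0 i <= c i + t)).
  rewrite negb_and -!ltNge => ci.
  have [e e0 ye] : exists2 e, 0 < e & forall d, 0 < d -> d < e ->
      ~ subcube a l x (t + d) y.
    case/orP: ci => ci; [exists (c i - y ord0 i)|exists (y ord0 i - (c i + t))];
      rewrite ?subr_gt0// => d d0 de /in_subcube/(_ i)/andP[h1 h2];
      have td : t <= t + d by lra.
    - have := corner_lipschitz (a ord0 i) l (x ord0 i) td; rewrite -/(c i); lra.
    - have := corner_nonincr (a ord0 i) l (x ord0 i) td; rewrite -/(c i); lra.
  have [k _ /(_ k (leqnn k)) ke] := small _ e0.
  by apply: (ye _ _ ke) => //; have [] := h k I.
have gap i : \forall k \near \oo, k.+1%:R^-1 < Num.min (y ord0 i - c i) (c i + t - y ord0 i).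
  apply: small; have [y1 y2] := yc i.
  have /andP[y3 y4] : c i <= y ord0 i <= c i + t.
    by apply: contrapT => ?; apply: inside; exists i.
  by rewrite lt_min !subr_gt0 !lt_neqAle y3 y4 y2 eq_sym y1.
have [k _ /(_ k (leqnn k)) ke] := filter_forall _ gap.
have [_] := h k I; apply; apply/in_subcube => i; have := ke i.
rewrite lt_min => /andP[]; set d := _^-1 => d1 d2.
have d0 : 0 <= d by rewrite invr_ge0 ler0n.
have td : t - d <= t by lra.
have := corner_lipschitz (a ord0 i) l (x ord0 i) td.
have := corner_nonincr (a ord0 i) l (x ord0 i) td.
rewrite -/(c i); lra.
Qed.

(** Sides at distance less than [d] of [t] give cubes that differ by less than
    the shell between the sides [t - d] and [t + d]; these shells shrink to a
    set contained in the null faces. *)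
Lemma subcube_measure_continuous a l x (F : set T) : measurable F ->
  continuous (fun t => fine (mu (subcube a l x t `&` F))).
Proof.
move=> mF; suff main (t e : R) : 0 < e -> exists2 d, 0 < d & forall s, `|t - s| < d ->
    `|fine (mu (subcube a l x t `&` F)) - fine (mu (subcube a l x s `&` F))| <= e.
  move=> t; apply/cvgrPdist_le => e /(main t)[d d0 hd].
  by exists d => //= s; exact: hd.
move=> e0; have mS s : measurable (subcube a l x s : set T) by exact: measurable_cube.
pose D k := shell a l x t k.+1%:R^-1.
have mD k : measurable (D k) by exact: measurableD.
have D0 : mu (\bigcap_k D k) = 0%E.
  apply: measure_negligible; first exact: bigcap_measurableType.
  exact: negligibleS (@shell_faces _ _ _ _) (@faces_null _ _ _ _).
have muD k : (mu (D k) < +oo)%E.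
  apply: le_lt_trans (_ : mu (subcube a l x (t + k.+1%:R^-1) `&` setT) < _)%E; last first.
    by rewrite -ge0_fin_numE//; exact: fin_num_subcube.
  by apply: le_measure; rewrite ?inE ?setIT//; exact: subDsetl.
have Dmono : {homo D : p q / (p <= q)%N >-> (q <= p)%O}.
  move=> p q pq; apply/subsetPset => y [y1 y2].
  have pq' : q.+1%:R^-1 <= p.+1%:R^-1 :> R by rewrite lef_pV2 ?posrE// ler_nat.
  split; first by apply: subcube_sub y1; rewrite lerD2l.
  by move=> y3; apply: y2; apply: subcube_sub y3; rewrite lerB.
have mcap : measurable (\bigcap_k D k) by exact: bigcap_measurableType.
have := nonincreasing_cvg_mu (muD 0%N) mD mcap Dmono.
rewrite D0 => /fine_cvgP[_] /cvgrPdist_le /(_ _ e0) [k _ /(_ k (leqnn k))] /=.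
rewrite sub0r normrN => De.
exists k.+1%:R^-1 => [|s ts]; first by rewrite invr_gt0 ltr0n.
set d := k.+1%:R^-1 in De ts *.
pose m s := fine (mu (subcube a l x s `&` F)).
have mmono s1 s2 : s1 <= s2 -> m s1 <= m s2.
  move=> s12; rewrite fine_le ?fin_num_subcube//.
  apply: le_measure; rewrite ?inE; [exact: measurableI..|].
  by apply: setSI; exact: subcube_sub.
have mD' : m (t + d) - m (t - d) <= fine (mu (D k)).
  have finD : mu (D k) \is a fin_num by rewrite ge0_fin_numE.
  rewrite lerBlDr -lee_fin EFinD !fineK //; try exact: fin_num_subcube.
  have mB : measurable (subcube a l x (t - d) `&` F) by exact: measurableI.
  apply: le_trans (measureU2 mu (mD k) mB).
  apply: le_measure; rewrite ?inE; [exact: measurableI|exact: measurableU (mD k) mB|].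
  by move=> y [y1 y2]; have [?|?] := pselect (subcube a l x (t - d) y); [right|left].
move: ts; rewrite ltr_distl => /andP[ts1 ts2].
have d0 : 0 <= d by rewrite invr_ge0 ler0n.
have t1 : t - d <= s by lra.
have t2 : s <= t + d by lra.
have t3 : t - d <= t by rewrite gerBl. have t4 : t <= t + d by rewrite lerDl.
have := mmono _ _ t1; have := mmono _ _ t2; have := mmono _ _ t3; have := mmono _ _ t4.
rewrite -/(m t) -/(m s) => m4 m3 m2 m1. rewrite ler_norml; move: (le_trans (ler_norm _) De); lra.
Qed.

(** Intermediate value theorem for the filled proportion between the sides [t]
    and [l]. *)
Lemma balanced_subcube a l x t (E : set T) : measurable E -> 0 < t <= l ->
  (mu (subcube a l x t) <= 2%:E * mu (subcube a l x t `&` E))%E ->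
  (2%:E * mu (subcube a l x l `&` E) <= mu (subcube a l x l))%E ->
  exists2 s, 0 < s <= l & mu (subcube a l x s) = (2%:E * mu (subcube a l x s `&` E))%E.
Proof.
move=> mE /andP[t0 tl].
pose m (F : set T) s := fine (mu (subcube a l x s `&` F)).
have mT s : mu (subcube a l x s) = (m setT s)%:E.
  by rewrite fineK ?fin_num_subcube// setIT.
have mEs s : mu (subcube a l x s `&` E) = (m E s)%:E.
  by rewrite fineK ?fin_num_subcube.
rewrite !mT !mEs -!EFinM !lee_fin => ht hl.
pose g s := 2 * m E s - m setT s.
have [s] : exists2 s, s \in `[t, l] & g s = 0.
  apply: IVT => //; last by rewrite ge_min le_max; apply/andP; split; apply/orP; [right|left]; rewrite /g; lra.
  apply: continuous_subspaceT => s; apply: cvgB; last exact: subcube_measure_continuous.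
  by apply: cvgM; [exact: cvg_cst|exact: subcube_measure_continuous].
rewrite in_itv /= => /andP[ts sl] gs; exists s; first lra.
rewrite mT mEs -EFinM; congr EFin; move: gs; rewrite /g; lra.
Qed.

End BalancedCubes.

(** * A density theorem *)
Section Density.
Context {R : realType} {n : nat}.
Local Notation T := (borelRn R n).
Local Notation V := 'rV[R]_n.
Implicit Types (a x y z : V) (l t s : R).
Variable mu : {measure set T -> \bar R}.
Hypothesis cube_mass : forall Q : set T, cubes Q -> (0 < mu Q < +oo)%E.
Hypothesis outer_regular : forall A : set T, measurable A ->
  mu A = ereal_inf [set mu U | U in [set U : set V | open U /\ A `<=` U]].

Lemma open_hull (A : set T) (e : R) : measurable A -> mu A \is a fin_num -> 0 < e ->
  exists U : set V, [/\ open U, A `<=` U & (mu ((U : set T) `\` A) <= e%:E)%E].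
Proof.
move=> mA finA e0.
have : (mu A < mu A + e%:E)%E by rewrite lteDl.
rewrite {1}outer_regular// => /ereal_inf_lt[_ [U [oU AU] <-]] Ue.
exists U; split => //.
have mU := measurable_open_borel oU.
have finU : mu (U : set T) \is a fin_num.
  by rewrite ge0_fin_numE//; apply: lt_trans Ue _; rewrite ltey_eq fin_numD finA.
rewrite measureD// -?ge0_fin_numE// setIidr// leeBlDl//.
exact: ltW.
Qed.

Lemma open_subcube (U : set V) a l x : open U -> 0 < l -> cube a l x -> U x ->
  exists2 t, 0 < t <= l & subcube a l x t `<=` U.
Proof.
move=> oU l0 ax Ux.
have /nbhs_ballP[e /= e0 eU] : nbhs x U by exact: open_nbhs_nbhs.
have t0 : 0 < Num.min l (e / 2) by rewrite lt_min l0 divr_gt0.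
have tl : Num.min l (e / 2) <= l by rewrite ge_min lexx.
exists (Num.min l (e / 2)); first by rewrite t0.
move=> y /in_subcube h; apply: eU; split => // i j; rewrite (ord1 i).
have := @corner_close _ (a ord0 j) l _ _ _ _ (ax j) (h j).
rewrite (ltW t0) tl => /(_ isT) yx; rewrite /ball/= distrC.
apply: le_lt_trans yx _; rewrite gt_min; apply/orP; right; lra.
Qed.

(** A substitute for the Lebesgue density theorem.  If the points in question
    were many, they could be covered by cubes inside an open hull [U] of [E]
    with at least half of their mass in [U] minus [E], which by
    [covering_estimate] bounds them by the arbitrarily small [mu (U `\` E)]. *)
Lemma density_negligible a l (E : set T) : 0 < l -> measurable E ->
  E `<=` cube a l ->
  mu.-negligible [set x : T | E x /\ forall t, 0 < t <= l ->
    (2%:E * mu (subcube a l x t `&` E) < mu (subcube a l x t))%E].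
Proof.
move=> l0 mE Ea; set N := [set x | _].
have cQ : cubes (cube a l) by exists a, l.
have finE := fin_num_subset cube_mass cQ mE Ea.
pose B := (overlap_bound n)%:R : R.
have key (e : R) : 0 < e -> exists G : set T, [/\ measurable G, N `<=` G &
    (mu G <= (2 * B * e)%:E)%E].
  move=> e0; have [U [oU EU Ue]] := open_hull mE finE e0.
  have /choice[r rP] : forall x : V, exists t, N x ->
      0 < t <= l /\ subcube a l x t `<=` U.
    move=> x; have [[Ex _]|Nx] := pselect (N x); last by exists 0.
    by have [t t0 tU] := open_subcube oU l0 (Ea _ Ex) (EU _ Ex); exists t.
  have mU : measurable ((U : set T) `\` E).
    by apply: measurableD => //; exact: measurable_open_borel.
  have [||x|x Nx|G [mG NG Ge]] := @covering_estimate R n mu a l N r ((U : set T) `\` E) 2 l0 _ _ _ mU _.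
  - by [].
  - by move=> x [/Ea].
  - by move=> /rP[].
  - have [r0 rU] := rP _ Nx; have [_ /(_ _ r0)] := Nx.
    have mS : measurable (subcube a l x (r x) : set T) by exact: measurable_cube.
    rewrite setIDA (setIidl rU).
    set u := mu (_ `\` _); set v := mu (_ `&` _).
    have -> : mu (subcube a l x (r x)) = (u + v)%E by exact: measureDI.
    have fv : v \is a fin_num by exact: fin_num_subcube.
    have fu : u \is a fin_num.
      by rewrite /u setDE; apply: fin_num_subcube => //; exact: measurableC.
    rewrite -(fineK fu) -(fineK fv) -EFinD -!EFinM lte_fin lee_fin; lra.
  exists G; split => //; apply: le_trans Ge _.
  by rewrite [leRHS]EFinM lee_wpmul2l // lee_fin mulr_ge0.
have B0 : 0 <= B by [].
have e0 k : 0 < ((2 * B + 1) * k.+1%:R)^-1 :> R by rewrite invr_gt0 mulr_gt0//; lra.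
have /choice[G GP] := fun k => key _ (e0 k).
have mG : measurable (\bigcap_k G k) by apply: bigcap_measurableType => k; have [] := GP k.
exists (\bigcap_k G k); split => //; last first.
  by move=> x Nx k _; have [_ /(_ x Nx)] := GP k.
apply/eqP; rewrite eq_le measure_ge0 andbT.
apply/lee_addgt0Pr => e ee; rewrite add0e.
have [k _ /(_ k (leqnn k)) ke] := near_infty_natSinv_lt (PosNum ee).
have [mGk _ Gk] := GP k.
apply: le_trans (_ : mu (G k) <= _)%E.
  by apply: le_measure; rewrite ?inE//; exact: bigcap_inf.
apply: le_trans Gk _; rewrite lee_fin; apply: le_trans (ltW ke).
rewrite invfM mulrA ler_piMl// ler_pdivrMr; lra.
Qed.

End Density.

(** * The modulus of complex numbers *)
Section Modulus.
Context {R : realType}.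
Implicit Types y z : R[i].

Lemma cabs_ge0 (x : R[i]) : 0 <= cabs x.
Proof. by case: x => a b; rewrite /cabs /= sqrtr_ge0. Qed.

Lemma cabs_distC (x y : R[i]) : cabs (x - y) = cabs (y - x).
Proof. by rewrite -opprB; exact: normcN. Qed.

Lemma cabs_triangle (y x z : R[i]) : cabs (x - z) <= cabs (x - y) + cabs (y - z).
Proof. by rewrite -[x - z](subrKA y); exact: le_normcD. Qed.

Lemma Re_le_cabs (x : R[i]) : `|complex.Re x| <= cabs x.
Proof.
case: x => a b; rewrite /cabs /= -sqrtr_sqr ler_sqrt ?addr_ge0 ?sqr_ge0//.
by rewrite lerDl sqr_ge0.
Qed.

Lemma Im_le_cabs (x : R[i]) : `|complex.Im x| <= cabs x.
Proof.
case: x => a b; rewrite /cabs /= -sqrtr_sqr ler_sqrt ?addr_ge0 ?sqr_ge0//.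
by rewrite lerDr sqr_ge0.
Qed.

Lemma cabs_le_ReIm (x : R[i]) : cabs x <= `|complex.Re x| + `|complex.Im x|.
Proof.
case: x => a b; rewrite /cabs /= -[leRHS]ger0_norm ?addr_ge0// -sqrtr_sqr.
rewrite ler_sqrt ?sqr_ge0// sqrrD !real_normK ?num_real// lerD2r lerDl.
by rewrite mulrn_wge0// mulr_ge0.
Qed.

Lemma measurable_cabs {n : nat} (f : borelRn R n -> R[i]) (c : R[i]) :
  cmeasurable f -> measurable_fun setT (fun x => cabs (f x - c)).
Proof.
move=> [mRe mIm].
have -> : (fun x => cabs (f x - c)) = Num.sqrt \o (fun x =>
   (complex.Re (f x) - complex.Re c) ^+ 2 + (complex.Im (f x) - complex.Im c) ^+ 2).
  by apply/funext => x /=; rewrite /cabs; case: (f x) c => a b [d e].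
apply: measurableT_comp; first exact: (continuous_measurable_fun (@sqrt_continuous R)).
by apply: measurable_funD; apply: measurable_funX; exact: measurable_funB.
Qed.

End Modulus.

(** * Geometric decay of the superlevel sets *)
Section Decay.
Context {R : realType} {n : nat}.
Local Notation T := (borelRn R n).
Local Notation V := 'rV[R]_n.
Implicit Types (a x y z : V) (l t s : R).

Definition superlevel (f : T -> R[i]) (Q : set T) (c : R[i]) (t : R) : set T :=
  [set x | Q x /\ t < cabs (f x - c)].

(** How an [A_infty] weight enters: a large share of [mu] forces a fixed share of
    [nu], at the threshold 1/4 at which [approx_by] is set. *)
Definition comparable_measure (mu nu : set T -> \bar R) (K : R) : Prop :=
  [/\ 0 < K,
      forall Q, cubes Q -> (0 < nu Q < +oo)%E,
      forall N, measurable N -> mu N = 0%E -> nu N = 0%E &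
      forall Q F, cubes Q -> measurable F -> F `<=` Q ->
        (mu Q <= 4%:E * mu F)%E -> (nu Q <= K%:E * nu F)%E].

Definition approx_by (mu : set T -> \bar R) (f : T -> R[i]) (A : R)
    (c : set T -> R[i]) : Prop :=
  forall Q, cubes Q -> (4%:E * mu (superlevel f Q (c Q) A) <= mu Q)%E.

Lemma measurable_superlevel f Q c t : cmeasurable f -> measurable Q ->
  measurable (superlevel f Q c t).
Proof.
move=> mf mQ; have := measurable_cabs c mf measurableT (measurable_itv `]t, +oo[).
rewrite setTI => /(measurableI _ _ mQ); congr measurable.
by apply/seteqP; split => x [Qx]; rewrite /= in_itv /= andbT.
Qed.

Lemma superlevel_anti f Q c s t : s <= t ->
  superlevel f Q c t `<=` superlevel f Q c s.
Proof. by move=> st x [Qx xt]; split => //; exact: le_lt_trans xt. Qed.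

Variable mu : {measure set T -> \bar R}.
Hypothesis cube_mass : forall Q : set T, cubes Q -> (0 < mu Q < +oo)%E.
Hypothesis hyperplane_null : forall (i : 'I_n) (c : R),
  mu (coord_hyperplane i c) = 0%E.
Hypothesis outer_regular : forall A : set T, measurable A ->
  mu A = ereal_inf [set mu U | U in [set U : set V | open U /\ A `<=` U]].

Definition decay_rate (K : R) : R :=
  K * (overlap_bound n)%:R / (1 + K * (overlap_bound n)%:R).

Section Step.
Variables (nu : {measure set T -> \bar R}) (K : R).
Hypothesis nuK : comparable_measure mu nu K.
Variables (f : T -> R[i]) (A : R) (c : set T -> R[i]).
Hypotheses (mf : cmeasurable f) (A0 : 0 < A) (fA : approx_by mu f A c).

(** The part [H] of [Q'] away from [c Q'] has at most a quarter of its mass, so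
    the half occupied by [E (t + 2 * A)] contains a point [y] outside [H].  This
    point shows that [c Q'] is farther than [t + A] from [c Q], so all of [Q']
    outside [H] lies in [E t]; at least a quarter is then left for the
    difference of the two superlevel sets. *)
Lemma balanced_drop (Q Q' : set T) (t : R) : cubes Q -> cubes Q' -> Q' `<=` Q ->
  let E s := superlevel f Q (c Q) s in
  mu Q' = (2%:E * mu (Q' `&` E (t + 2 * A)%R))%E ->
  (nu Q' <= K%:E * nu (Q' `&` (E t `\` E (t + 2 * A)%R)))%E.
Proof.
move=> cQ cQ' QQ' E half; have [_ _ _ nuKF] := nuK.
have mQ := measurable_cubes cQ; have mQ' := measurable_cubes cQ'.
have mE s : measurable (E s) by exact: measurable_superlevel.
pose H := superlevel f Q' (c Q') A.
have mH : measurable H by exact: measurable_superlevel.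
have fin (X : set T) : measurable X -> X `<=` Q' -> mu X \is a fin_num.
  exact: (fin_num_subset cube_mass cQ').
have finQ' : mu Q' \is a fin_num by exact: fin.
have mEH : measurable (Q' `&` E (t + 2 * A)%R) by exact: measurableI.
have finEH : mu (Q' `&` E (t + 2 * A)%R) \is a fin_num by apply: fin => // x [].
have finH : mu H \is a fin_num by apply: fin => // x [].
have pos : 0 < fine (mu Q').
  by have /andP[q0 qoo] := cube_mass cQ'; rewrite fine_gt0// q0.
have hQ : fine (mu Q') = 2 * fine (mu (Q' `&` E (t + 2 * A)%R)).
  by rewrite half fineM.
have hH : 4 * fine (mu H) <= fine (mu Q').
  by have := fA cQ'; rewrite -(fineK finQ') -(fineK finH) -EFinM lee_fin.
have [y [[Q'y [Qy yt]] yH]] : exists y, (Q' `&` E (t + 2 * A)%R) y /\ ~ H y.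
  apply: contrapT => nex.
  have : (mu (Q' `&` E (t + 2 * A)%R) <= mu H)%E.
    apply: le_measure; rewrite ?inE// => y Ey; apply: contrapT => Hy.
    by apply: nex; exists y.
  rewrite -(fineK finEH) -(fineK finH) lee_fin; lra.
have {}yH : cabs (f y - c Q') <= A by rewrite leNgt; apply/negP => ?; apply: yH.
set F := Q' `&` _.
have mF : measurable F by apply: measurableI => //; exact: measurableD.
have FQ' : F `<=` Q' by move=> x [].
have finF : mu F \is a fin_num by exact: fin.
apply: nuKF => //.
have : (mu Q' <= mu F + mu (Q' `&` E (t + 2 * A)%R) + mu H)%E.
  apply: le_trans (_ : mu ((F `|` (Q' `&` E (t + 2 * A)%R)) `|` H) <= _)%E; last first.
    apply: le_trans (measureU2 mu (measurableU _ _ mF mEH) mH) _.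
    by rewrite leeD2r//; exact: (measureU2 mu mF mEH).
  apply: le_measure; rewrite ?inE//; first by do 2!apply: measurableU => //.
  move=> x Q'x; have [Hx|Hx] := pselect (H x); [by right|left].
  have [Ex|Ex] := pselect (E (t + 2 * A)%R x); [by right|left].
  split => //; split => //; split; first exact: QQ'.
  have {}Hx : cabs (f x - c Q') <= A by rewrite leNgt; apply/negP => ?; apply: Hx.
  have := cabs_triangle (c Q') (f y) (c Q).
  have := cabs_triangle (f x) (c Q') (c Q).
  rewrite (cabs_distC (c Q') (f x)); lra.
rewrite -(fineK finQ') -(fineK finEH) -(fineK finH) -(fineK finF) -!EFinD -EFinM !lee_fin.
lra.
Qed.

(** With [B := K * overlap_bound n], [covering_estimate] over the half-filled cubes
    gives [nu (E (t + 2 * A)) <= B * (nu (E t) - nu (E (t + 2 * A)))], that is,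
    the ratio [B / (1 + B)]. *)
Lemma decay_step (Q : set T) (t : R) : cubes Q -> A <= t ->
  (nu (superlevel f Q (c Q) (t + 2 * A)%R) <=
   (decay_rate K)%:E * nu (superlevel f Q (c Q) t))%E.
Proof.
move=> cQ At; pose E s := superlevel f Q (c Q) s.
rewrite -/(E t) -/(E (t + 2 * A)); have [K0 nu_mass nu0 _] := nuK.
have mQ := measurable_cubes cQ.
have mE s : measurable (E s) by exact: measurable_superlevel.
have finnu s : nu (E s) \is a fin_num.
  by apply: (fin_num_subset nu_mass cQ) => // x [].
have [a [l [l0 QE]]] := cQ.
(* The exceptional set of the density theorem, enlarged to a measurable [N']. *)
pose N := [set x : T | E (t + 2 * A)%R x /\ forall s, 0 < s <= l ->
    (2%:E * mu (subcube a l x s `&` E (t + 2 * A)%R) < mu (subcube a l x s))%E].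
have EQ s : E s `<=` cube a l by move=> x []; rewrite QE.
have [N' [mN' N'0 NN']] : mu.-negligible N by exact: density_negligible.
have /choice[r rP] : forall x : V, exists s, E (t + 2 * A)%R x -> ~ N' x ->
    0 < s <= l /\ mu (subcube a l x s) =
      (2%:E * mu (subcube a l x s `&` E (t + 2 * A)%R))%E.
  move=> x; have [Ex|] := pselect (E (t + 2 * A)%R x); last by exists 0.
  have [|N'x] := pselect (N' x); first by exists 0.
  have [s [s0 hs]] : exists s, 0 < s <= l /\
      (mu (subcube a l x s) <= 2%:E * mu (subcube a l x s `&` E (t + 2 * A)%R))%E.
    apply: contrapT => nex; apply: N'x; apply: NN'; split => // s s0.
    by rewrite ltNge; apply/negP => h; apply: nex; exists s.
  have [|s' s'0 s'P] := balanced_subcube cube_mass hyperplane_null (mE (t + 2 * A)%R) s0 hs.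
    rewrite subcube_top; last exact: EQ Ex.
    rewrite setIidr// -QE.
    have fE : mu (E (t + 2 * A)%R) \is a fin_num.
      by apply: (fin_num_subset cube_mass cQ) => // y [].
    have fA' : mu (E A) \is a fin_num.
      by apply: (fin_num_subset cube_mass cQ) => // y [].
    have fQ : mu Q \is a fin_num by exact: (fin_num_subset cube_mass cQ).
    have hA := fA cQ; rewrite -/(E A) in hA.
    have h1 : (mu (E (t + 2 * A)%R) <= mu (E A))%E.
      have At2 : A <= t + 2 * A by rewrite (le_trans At)// lerDl mulr_ge0 ?ltW.
      by apply: le_measure; rewrite ?inE//; exact: superlevel_anti.
    have : (0 <= mu (E A))%E by [].
    move: hA h1; rewrite -(fineK fE) -(fineK fA') -(fineK fQ) -!EFinM !lee_fin; lra.
  by exists s'.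
have mD : measurable (E t `\` E (t + 2 * A)%R) by exact: measurableD.
have [||x [Ex N'x]|x [Ex N'x]|G [mG AG Gle]] :=
  @covering_estimate R n nu a l (E (t + 2 * A)%R `\` N') r (E t `\` E (t + 2 * A)%R) K l0 _ _ _ mD _.
- exact: ltW.
- by move=> x [/EQ].
- by have [] := rP x Ex N'x.
- have [/andP[r0 rl] rP'] := rP x Ex N'x.
  apply: balanced_drop => //; first exact: subcube_cubes.
  by rewrite QE; apply: subcube_subcube => //; exact: EQ Ex.
have nuN' : nu N' = 0%E by exact: nu0.
have le1 : (nu (E (t + 2 * A)%R) <= nu G)%E.
  apply: le_trans (_ : nu (G `|` N') <= _)%E.
    apply: le_measure; rewrite ?inE//; first exact: measurableU.
    by move=> x Ex; have [?|?] := pselect (N' x); [right|left; exact: AG].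
  by rewrite -[leRHS]adde0 -nuN'; exact: measureU2.
have := le_trans le1 Gle.
have sub : E (t + 2 * A)%R `<=` E t by apply: superlevel_anti; rewrite lerDl mulr_ge0 ?ltW.
have -> : nu (E t `\` E (t + 2 * A)%R) = (nu (E t) - nu (E (t + 2 * A)%R))%E.
  have finEt : (nu (E t) < +oo)%E by rewrite -ge0_fin_numE.
  rewrite measureD//.
  by congr (_ - nu _)%E; exact: setIidr.
rewrite -(fineK (finnu t)) -(fineK (finnu (t + 2 * A))) -EFinB -!EFinM !lee_fin.
set u := fine _; set v := fine _; rewrite /decay_rate; set KB := K * _ => h.
have KB0 : 0 <= KB by rewrite mulr_ge0// ltW.
rewrite mulrAC ler_pdivlMr; [nra|lra].
Qed.

Lemma decay (Q : set T) (k : nat) : cubes Q ->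
  (nu (superlevel f Q (c Q) ((2 * k%:R + 1) * A)%R) <= (decay_rate K ^+ k)%:E * nu Q)%E.
Proof.
move=> cQ; have mQ := measurable_cubes cQ.
have [K0 _ _ _] := nuK.
elim: k => [|k IH].
  rewrite expr0 mul1e; apply: le_measure; rewrite ?inE//; last by move=> x [].
  exact: measurable_superlevel.
have -> : (2 * k.+1%:R + 1) * A = (2 * k%:R + 1) * A + 2 * A by rewrite -natr1; ring.
apply: le_trans (decay_step cQ _) _.
  by apply: ler_peMl; [exact: ltW|rewrite lerDr mulr_ge0].
have rate0 : 0 <= decay_rate K by rewrite divr_ge0// ?addr_ge0// mulr_ge0// ltW.
by rewrite exprS [in leRHS]EFinM -muleA lee_wpmul2l ?lee_fin.
Qed.

End Step.
End Decay.

(** * From the decay to means of all orders *)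
Section GeometricDomination.
Context {R : realType}.

Lemma bernoulli_natmul (d : R) (k : nat) : 0 <= d -> 1 + k%:R * d <= (1 + d) ^+ k.
Proof.
move=> d0; elim: k => [|k IH]; first by rewrite mul0r addr0 expr0.
have h : (1 + d) * (1 + k%:R * d) <= (1 + d) ^+ k.+1.
  by rewrite exprS ler_wpM2l// addr_ge0.
apply: le_trans h; rewrite -natr1.
have : 0 <= k%:R * d * d by rewrite !mulr_ge0.
lra.
Qed.

(** Bernoulli applied to [b] with [b `^ p = q^-1]. *)
Lemma powR_le_geometric (p q : R) : 0 < p -> 0 < q < 1 ->
  exists2 M, 0 < M & forall k, (2 * k%:R + 3) `^ p <= M * (q ^+ k)^-1.
Proof.
move=> p0 /andP[q0 q1].
pose b := q^-1 `^ p^-1; have b1 : 1 < b.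
  have -> : 1 = 1 `^ p^-1 :> R by rewrite powR1.
  rewrite /b gt0_ltr_powR ?invr_gt0// ?nnegrE ?invr_ge0 ?ltW//.
  by rewrite invf_gt1.
pose d := b - 1; have d0 : 0 < d by rewrite subr_gt0.
pose M := 3 + 2 / d.
have M0 : 0 < M by rewrite addr_gt0// divr_gt0.
exists (M `^ p) => [|k]; first by rewrite powR_gt0.
have b0 : 0 <= b by lra.
have -> : (q ^+ k)^-1 = (b ^+ k) `^ p.
  have bp : b `^ p = q^-1.
    by rewrite -powRrM mulVf ?gt_eqF// powRr1 ?invr_ge0 ?ltW.
  rewrite -(powR_mulrn k b0) -powRrM mulrC powRrM bp.
  by rewrite powR_mulrn ?invr_ge0 ?ltW// exprVn.
rewrite -powRM ?exprn_ge0 ?(ltW M0)//.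
apply: ge0_ler_powR; rewrite ?nnegrE ?addr_ge0 ?mulr_ge0 ?exprn_ge0 ?(ltW M0) ?(ltW p0)//.
have := bernoulli_natmul k (ltW d0); rewrite (_ : 1 + d = b); last by rewrite /d; ring.
move=> /(ler_wpM2l (ltW M0)); apply: le_trans.
have -> : M * (1 + k%:R * d) = 3 + 2 / d + 3 * k%:R * d + 2 * k%:R.
  by rewrite /M; field; rewrite gt_eqF.
have : 0 <= 3 * k%:R * d by rewrite !mulr_ge0// ltW.
have : 0 <= 2 / d by rewrite divr_ge0// ltW.
lra.
Qed.

Lemma geometric_partial_sum (q : R) N : 0 <= q < 1 ->
  \sum_(0 <= k < N) q ^+ k <= (1 - q)^-1.
Proof.
move=> /andP[q0 q1]; have q1' : 0 < 1 - q by lra.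
rewrite -[leRHS]mul1r ler_pdivlMr//.
suff -> : (\sum_(0 <= k < N) q ^+ k) * (1 - q) = 1 - q ^+ N.
  by rewrite gerBl exprn_ge0.
elim: N => [|N IH]; first by rewrite big_geq// mul0r expr0 subrr.
by rewrite big_nat_recr//= mulrDl IH exprS; ring.
Qed.

End GeometricDomination.

Section Oscillation.
Context {R : realType} {n : nat}.
Local Notation T := (borelRn R n).
Local Notation V := 'rV[R]_n.

Definition Lp_bound (nu : set T -> \bar R) (p : R) (f : T -> R[i]) (A : R)
    (c : set T -> R[i]) : Prop :=
  forall Q, cubes Q ->
    (\int[nu]_(x in Q) ((cabs (f x - c Q)) `^ p)%:E <= (A `^ p)%:E * nu Q)%E.

Lemma measurable_cabs_powR (f : T -> R[i]) c p (Q : set T) : cmeasurable f ->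
  measurable_fun Q (fun x => (cabs (f x - c) `^ p)%:E).
Proof.
move=> mf; apply/measurable_EFinP/(measurableT_comp (measurable_powR p)).
exact: measurable_funTS (measurable_cabs c mf).
Qed.

Lemma Lp_bound1 (nu : set T -> \bar R) f A c : 0 <= A -> Lp_bound nu 1 f A c <->
  forall Q, cubes Q -> (\int[nu]_(x in Q) (cabs (f x - c Q))%:E <= A%:E * nu Q)%E.
Proof.
move=> A0; rewrite /Lp_bound powRr1//.
have e Q : (\int[nu]_(x in Q) ((cabs (f x - c Q)) `^ 1)%:E =
            \int[nu]_(x in Q) (cabs (f x - c Q))%:E)%E.
  by congr (integral _ _ _); apply/funext => x; rewrite powRr1 ?cabs_ge0.
by split=> h Q /h; rewrite e.
Qed.

Variable mu : {measure set T -> \bar R}.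
Hypothesis cube_mass : forall Q : set T, cubes Q -> (0 < mu Q < +oo)%E.
Hypothesis hyperplane_null : forall (i : 'I_n) (c : R),
  mu (coord_hyperplane i c) = 0%E.
Hypothesis outer_regular : forall A : set T, measurable A ->
  mu A = ereal_inf [set mu U | U in [set U : set V | open U /\ A `<=` U]].

Variables (nu : {measure set T -> \bar R}) (K : R).
Hypothesis nuK : comparable_measure mu nu K.

(** Layer by layer: the layer where [|f - c Q|] is between [(2k + 1) A] and
    [(2k + 3) A] has mass at most [theta ^ k * nu Q], and [(2k + 3) ^ p] grows
    slower than [q ^ - k] for any [q < 1]; choosing [theta <= q ^ 2] leaves a
    geometric series of ratio [q]. *)
Lemma approx_Lp_bound (p : R) : 0 < p ->
  exists2 D, 0 < D & forall f A c, cmeasurable f -> 0 < A ->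
    approx_by mu f A c -> Lp_bound nu p f (D * A) c.
Proof.
move=> p0; have [K0 nu_mass _ _] := nuK.
pose theta := @decay_rate R n K.
have KB0 : 0 <= K * (overlap_bound n)%:R by rewrite mulr_ge0// ltW.
have theta01 : 0 <= theta < 1.
  by rewrite /theta /decay_rate divr_ge0 ?addr_ge0//= ltr_pdivrMr; lra.
pose q := Num.sqrt ((1 + theta) / 2).
have q2 : q ^+ 2 = (1 + theta) / 2 by rewrite sqr_sqrtr; lra.
have q0 : 0 < q by rewrite sqrtr_gt0; lra.
have q01 : 0 < q < 1 by rewrite q0/= -(@ltr_pXn2r _ 2)// ?nnegrE ?ltW// q2 expr1n; lra.
have [M M0 hM] := powR_le_geometric p0 q01.
pose D' := M / (1 - q).
have D'0 : 0 < D' by rewrite divr_gt0//; lra.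
exists (D' `^ p^-1) => [|f A c mf A0 fA Q cQ]; first by rewrite powR_gt0.
have mQ := measurable_cubes cQ.
have finQ : nu Q \is a fin_num by exact: (fin_num_subset nu_mass cQ).
rewrite powRM ?powR_ge0 ?(ltW A0)// -powRrM mulVf ?gt_eqF// powRr1 ?(ltW D'0)//.
pose E k := superlevel f Q (c Q) ((2 * k%:R + 1) * A).
(* [F 0] is all of [Q], so that it also accounts for the part below [A]. *)
pose F k : set T := if k is 0%N then Q else E k.
have mF k : measurable (F k) by case: k => [//|k]; exact: measurable_superlevel.
have nuF k : (nu (F k) <= (theta ^+ k)%:E * nu Q)%E.
  case: k => [|k]; first by rewrite expr0 mul1e.
  exact: (decay cube_mass hyperplane_null outer_regular nuK mf A0 fA).
have FQ k : F k `<=` Q by case: k => [//|k] x [].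
pose a k := ((2 * k%:R + 3) * A) `^ p.
have a0 k : 0 <= a k by exact: powR_ge0.
apply: (@le_trans _ _ (\int[nu]_(x in Q) \sum_(0 <= k <oo) ((a k * \1_(F k) x)%:E))%E).
  apply: ge0_le_integral => //.
  - by move=> x _; rewrite lee_fin powR_ge0.
  - exact: measurable_cabs_powR.
  - apply: ge0_emeasurable_sum => [k x _ _|k _].
      by rewrite lee_fin mulr_ge0.
    by apply/measurable_EFinP; apply: measurable_funM => //; exact: measurable_indic.
  move=> x Qx; set u := cabs _; have u0 : 0 <= u by exact: cabs_ge0.
  have ex : exists k, u <= (2 * k%:R + 3) * A.
    exists (Num.bound (u / A)); rewrite -ler_pdivrMr//.
    have : u / A < (Num.bound (u / A))%:R by rewrite archi_boundP// divr_ge0// ltW.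
    have : 0 <= (Num.bound (u / A))%:R :> R by [].
    lra.
  have [k uk kmin] := ex_minnP ex.
  have Fx : F k x.
    case: k {uk} kmin => [//|k] kmin; split => //.
    rewrite ltNge; apply/negP => h; suff : (k.+1 <= k)%N by rewrite ltnn.
    by apply: kmin; move: h; rewrite -natr1; congr (_ <= _ * _); ring.
  apply: (@le_trans _ _ (\sum_(0 <= j < k.+1) (a j * \1_(F j) x)%:E)%E); last first.
    by apply: nneseries_lim_ge => j _ _; rewrite lee_fin mulr_ge0.
  rewrite big_nat_recr//= -[leLHS]add0e; apply: leeD.
    by apply: sume_ge0 => j _; rewrite lee_fin mulr_ge0.
  rewrite indicE mem_set// mulr1 lee_fin; apply: ge0_ler_powR => //.
  - exact: ltW.
  - by rewrite nnegrE mulr_ge0 ?addr_ge0 ?mulr_ge0// ltW.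
rewrite integral_nneseries//; last 2 first.
  by move=> k; apply/measurable_EFinP; apply: measurable_funM => //; exact: measurable_indic.
  by move=> k x _; rewrite lee_fin mulr_ge0.
apply: lime_le.
  by apply: is_cvg_nneseries => k _ _; apply: integral_ge0 => x _; rewrite lee_fin mulr_ge0.
apply: nearW => N.
have Ap0 : 0 <= A `^ p by exact: powR_ge0.
have nuQ0 : 0 <= fine (nu Q) by exact: fine_ge0.
apply: (@le_trans _ _ (\sum_(0 <= k < N) (M * A `^ p * fine (nu Q) * q ^+ k)%:E)%E).
  apply: lee_sum => k _.
  under eq_integral do rewrite EFinM.
  rewrite ge0_integralZl_EFin//; last by apply/measurable_EFinP; exact: measurable_indic.
  rewrite integral_indic// setIidl//.
  apply: le_trans (lee_wpmul2l _ (nuF k)) _; first by rewrite lee_fin.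
  rewrite -(fineK finQ) -!EFinM lee_fin /a powRM ?addr_ge0 ?mulr_ge0 ?(ltW A0)//.
  have thq : theta ^+ k <= q ^+ k * q ^+ k.
    by rewrite -exprD addnn -mul2n exprM q2; apply: lerXn2r; rewrite ?nnegrE; lra.
  have qk0 : 0 < q ^+ k by exact: exprn_gt0.
  have h1 : (2 * k%:R + 3) `^ p * theta ^+ k <= M * q ^+ k.
    apply: le_trans (_ : M * (q ^+ k)^-1 * (q ^+ k * q ^+ k) <= _).
      by apply: ler_pM => //; apply: exprn_ge0; lra.
    by rewrite -mulrA [_^-1 * _]mulrA mulVf ?gt_eqF// mul1r.
  have := ler_wpM2r (mulr_ge0 Ap0 nuQ0) h1; rewrite fineK//.
  by congr (_ <= _); ring.
rewrite sumEFin -mulr_sumr -[in leRHS](fineK finQ) -EFinM lee_fin.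
rewrite /D' [leRHS](_ : _ = M * A `^ p * fine (nu Q) * (1 - q)^-1); last by rewrite /D'; ring.
apply: ler_wpM2l; first by rewrite !mulr_ge0// ltW.
by apply: geometric_partial_sum; lra.
Qed.

End Oscillation.

(** * Means and the Chebyshev inequality *)
Section Means.
Context {R : realType} {n : nat}.
Local Notation T := (borelRn R n).

Lemma real_mean_dist (nu : {measure set T -> \bar R}) (Q : set T) (g : T -> R)
    (c : R) (h : T -> R) (e : R) : measurable Q -> (0 < nu Q < +oo)%E ->
  measurable_fun Q g -> measurable_fun Q h -> nu.-integrable Q (EFin \o g) ->
  (forall x, `|g x - c| <= h x) -> (\int[nu]_(x in Q) (h x)%:E <= e%:E * nu Q)%E ->
  `|(fine (nu Q))^-1 * fine (\int[nu]_(x in Q) (g x)%:E)%E - c| <= e.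
Proof.
move=> mQ /andP[nuQ0 nuQoo] mg mh ig gh he.
have finQ : nu Q \is a fin_num by rewrite ge0_fin_numE// ltW.
have Q0 : 0 < fine (nu Q) by rewrite fine_gt0// nuQ0.
have fing : (\int[nu]_(x in Q) (g x)%:E)%E \is a fin_num by exact: integrable_fin_num.
have ic : nu.-integrable Q (EFin \o cst c).
  apply/integrableP; split; first exact/measurable_EFinP.
  have -> : (\int[nu]_(x in Q) `|(EFin \o cst c) x| =
      \int[nu]_(x in Q) cst `|c|%:E x)%E by [].
  by rewrite integral_cst// lte_mul_pinfty.
have : (`|\int[nu]_(x in Q) ((g x)%:E - c%:E)| <= e%:E * nu Q)%E.
  apply: le_trans he; apply: le_trans (le_abse_integral _ mQ _) _.
    by apply/measurable_EFinP; exact: measurable_funB.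
  apply: ge0_le_integral => //.
  - by apply/measurable_EFinP; apply: measurableT_comp => //; exact: measurable_funB.
  - exact/measurable_EFinP.
  - by move=> x _; rewrite lee_fin; exact: gh.
rewrite (integralB mQ ig ic).
have -> : (\int[nu]_(x in Q) (EFin \o cst c) x = c%:E * nu Q)%E.
  exact: (integral_cst nu mQ c%:E).
rewrite -(fineK finQ) -(fineK fing) -EFinM -EFinB -EFinM abse_EFin lee_fin.
set I := fine (integral _ _ _); set v := fine _ => h1.
have -> : v^-1 * I - c = v^-1 * (I - c * v).
  by field; rewrite gt_eqF.
by rewrite normrM gtr0_norm ?invr_gt0// ler_pdivrMl// [v * e]mulrC.
Qed.

(** The factor 2 comes from treating real and imaginary parts separately. *)
Lemma cmean_dist (nu : {measure set T -> \bar R}) (Q : set T) (f : T -> R[i])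
    (c : R[i]) (e : R) : measurable Q -> (0 < nu Q < +oo)%E -> cmeasurable f ->
  (\int[nu]_(x in Q) (cabs (f x))%:E < +oo)%E ->
  (\int[nu]_(x in Q) (cabs (f x - c))%:E <= e%:E * nu Q)%E ->
  cabs (cmean nu Q f - c) <= 2 * e.
Proof.
move=> mQ nuQ mf fL he.
have mcabs d : measurable_fun Q (fun x => cabs (f x - d)).
  exact: measurable_funTS (measurable_cabs d mf).
have [mRe mIm] := mf.
have int (g : T -> R) : measurable_fun setT g -> (forall x, `|g x| <= cabs (f x)) ->
    nu.-integrable Q (EFin \o g).
  move=> mg gf; apply/integrableP; split.
    exact/measurable_EFinP/measurable_funTS.
  apply: le_lt_trans fL; apply: ge0_le_integral => //.
  - apply/measurable_EFinP; apply: measurableT_comp => //; exact: measurable_funTS.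
  - by apply/measurable_EFinP; have := mcabs 0; under eq_fun do rewrite subr0.
  - by move=> x _; rewrite lee_fin; exact: gf.
apply: le_trans (cabs_le_ReIm _) _; rewrite mulr_natl mulr2n.
have cE (z d : R[i]) (t : R) : complex.Re ((t%:C)%C * z - d) = t * complex.Re z - complex.Re d
    /\ complex.Im ((t%:C)%C * z - d) = t * complex.Im z - complex.Im d.
  by case: z d => z1 z2 [d1 d2] /=; split; ring.
have subRI (z d : R[i]) : complex.Re z - complex.Re d = complex.Re (z - d) /\
    complex.Im z - complex.Im d = complex.Im (z - d).
  by case: z d => z1 z2 [d1 d2].
rewrite /cmean; have [-> ->] := cE (cintegral nu Q f) c (fine (nu Q))^-1.
apply: lerD.
- apply: (@real_mean_dist nu Q (fun x => complex.Re (f x)) _ (fun x => cabs (f x - c))) => //.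
  + exact: measurable_funTS.
  + by apply: int => // x; exact: Re_le_cabs.
  + by move=> x; rewrite (subRI (f x) c).1; exact: Re_le_cabs.
- apply: (@real_mean_dist nu Q (fun x => complex.Im (f x)) _ (fun x => cabs (f x - c))) => //.
  + exact: measurable_funTS.
  + by apply: int => // x; exact: Im_le_cabs.
  + by move=> x; rewrite (subRI (f x) c).2; exact: Im_le_cabs.
Qed.

Variable mu : {measure set T -> \bar R}.
Hypothesis cube_mass : forall Q : set T, cubes Q -> (0 < mu Q < +oo)%E.
Hypothesis hyperplane_null : forall (i : 'I_n) (c : R),
  mu (coord_hyperplane i c) = 0%E.
Hypothesis outer_regular : forall A : set T, measurable A ->
  mu A = ereal_inf [set mu U | U in [set U : set 'rV[R]_n | open U /\ A `<=` U]].

Variables (nu : {measure set T -> \bar R}) (K : R).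
Hypothesis nuK : comparable_measure mu nu K.

(** By [approx_Lp_bound] with exponent 1, the mean over [Q] is within a multiple
    of [A] of [c Q]. *)
Lemma approx_cmean : exists2 D, 0 < D & forall f A c, cmeasurable f -> 0 < A ->
  approx_by mu f A c -> L1loc nu f /\ approx_by mu f (D * A) (cmean nu ^~ f).
Proof.
have [K0 nu_mass _ _] := nuK.
have [D D0 hD] := approx_Lp_bound cube_mass hyperplane_null outer_regular nuK ltr01.
exists (1 + 2 * D) => [|f A c mf A0 fA]; first by lra.
have DA0 : 0 <= D * A by rewrite mulr_ge0// ltW.
have /(Lp_bound1 _ _ _ DA0) osc := hD f A c mf A0 fA.
have mcabs Q d : measurable_fun Q (fun x => cabs (f x - d)).
  exact: measurable_funTS (measurable_cabs d mf).
have fL : L1loc nu f.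
  split=> // Q cQ; have mQ := measurable_cubes cQ.
  have finQ : nu Q \is a fin_num by exact: (fin_num_subset nu_mass cQ).
  apply: (@le_lt_trans _ _ (\int[nu]_(x in Q) ((cabs (f x - c Q))%:E + (cabs (c Q))%:E))%E).
    apply: ge0_le_integral => //.
    - by move=> x _; rewrite lee_fin cabs_ge0.
    - by apply/measurable_EFinP; have := mcabs Q 0; under eq_fun do rewrite subr0.
    - apply/measurable_EFinP; exact: measurable_funD.
    - move=> x _; rewrite lee_fin.
      by have := cabs_triangle (c Q) (f x) 0; rewrite !subr0.
  have m1 : measurable_fun Q (fun x => (cabs (f x - c Q))%:E) by exact/measurable_EFinP.
  have ge0 (z : R[i]) : (0 <= (cabs z)%:E)%E by rewrite lee_fin cabs_ge0.
  rewrite ge0_integralD//.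
  rewrite integral_cst//; apply: (@le_lt_trans _ _ ((D * A)%:E * nu Q + (cabs (c Q))%:E * nu Q)%E).
    by rewrite leeD2r// osc.
  by rewrite -(fineK finQ) -!EFinM -EFinD ltry.
split=> // Q cQ; have mQ := measurable_cubes cQ.
apply: le_trans (fA Q cQ); rewrite lee_pmul2l//.
apply: le_measure; rewrite ?inE; [exact: measurable_superlevel..|].
move=> x [Qx xA]; split=> //.
have := cmean_dist mQ (nu_mass _ cQ) mf (fL.2 Q cQ) (osc Q cQ).
have := cabs_triangle (c Q) (f x) (cmean nu Q f); rewrite (cabs_distC (c Q)).
lra.
Qed.

(** If more than a quarter of [Q] had [|f - c Q| > D A], then comparability would
    give this set at least [nu Q / K] of the weighted mass, and the p-th mean
    would exceed [D ^ p / K = 2] times its bound. *)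
Lemma Lp_bound_approx (p : R) : 0 < p ->
  exists2 D, 0 < D & forall f A c, cmeasurable f -> 0 < A ->
    Lp_bound nu p f A c -> approx_by mu f (D * A) c.
Proof.
move=> p0; have [K0 nu_mass _ nuKF] := nuK.
have K20 : 0 < 2 * K by lra.
exists ((2 * K) `^ p^-1) => [|f A c mf A0 fA Q cQ]; first by rewrite powR_gt0.
set D := _ `^ _; have mQ := measurable_cubes cQ.
have D0 : 0 < D by rewrite powR_gt0.
have Dp : D `^ p = 2 * K by rewrite /D -powRrM mulVf ?gt_eqF// powRr1// ltW.
rewrite leNgt; apply/negP => /ltW muS; set S := superlevel _ _ _ _ in muS.
have mS : measurable S by exact: measurable_superlevel.
have SQ : S `<=` Q by move=> x [].
have hS := nuKF Q S cQ mS SQ muS.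
have finQ : nu Q \is a fin_num by exact: (fin_num_subset nu_mass cQ).
have finS : nu S \is a fin_num by exact: (fin_num_subset nu_mass cQ).
have Q0 : 0 < fine (nu Q) by have /andP[h1 h2] := nu_mass Q cQ; rewrite fine_gt0// h1.
have : (((D * A) `^ p)%:E * nu S <= (A `^ p)%:E * nu Q)%E.
  apply: le_trans (fA Q cQ).
  apply: (@le_trans _ _ (\int[nu]_(x in S) (cabs (f x - c Q) `^ p)%:E)%E); last first.
    apply: ge0_subset_integral => //; first exact: measurable_cabs_powR.
    by move=> x _; rewrite lee_fin powR_ge0.
  rewrite -integral_cst//; apply: ge0_le_integral => //.
  - by move=> x _; rewrite lee_fin powR_ge0.
  - exact: measurable_cabs_powR.
  move=> x [_ xS]; rewrite lee_fin; apply: ge0_ler_powR; rewrite ?nnegrE ?cabs_ge0 ?(ltW p0)//.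
    by rewrite mulr_ge0// ltW.
  exact: ltW.
move: hS; rewrite -(fineK finS) -(fineK finQ) -!EFinM !lee_fin.
set s := fine (nu S); rewrite powRM ?(ltW A0) ?(ltW D0)// Dp.
have Ap : 0 < A `^ p by rewrite powR_gt0.
move=> h1 h2; have : 2 * K * s <= fine (nu Q) by rewrite -(ler_pM2l Ap); lra.
lra.
Qed.

End Means.

(** * Muckenhoupt weights *)
Section Weights.
Context {R : realType} {n : nat}.
Local Notation T := (borelRn R n).
Variable mu : {measure set T -> \bar R}.

Lemma wmeasure_is_measure (w : T -> R) : (forall x, 0 <= w x) ->
  measurable_fun setT w ->
  exists nu : {measure set T -> \bar R}, (nu : set T -> \bar R) = wmeasure mu w.
Proof.
move=> w0 mw; pose m := wmeasure mu w.
have m0 : m set0 = 0%E by rewrite /m /wmeasure integral_set0.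
have mge0 A : (0 <= m A)%E by apply: integral_ge0 => x _; rewrite lee_fin.
have msigma : semi_sigma_additive m.
  move=> F mF tF mUF; rewrite /m /wmeasure ge0_integral_bigcup//.
  - apply: is_cvg_ereal_nneg_natsum => k _; exact: mge0.
  - exact/measurable_EFinP/measurable_funTS.
  - by move=> x _; rewrite lee_fin.
pose mixin := isMeasure.Build _ _ _ m m0 mge0 msigma.
by exists (HB.pack_for {measure set T -> \bar R} m mixin).
Qed.

Hypothesis cube_mass : forall Q : set T, cubes Q -> (0 < mu Q < +oo)%E.

Lemma Ap_dualE (p : R) (w : T -> R) x : 1 < p ->
  Ap_dual p w x = if w x == 0 then +oo%E else (((w x)^-1) `^ (p - 1)^-1)%:E.
Proof.
move=> p1; rewrite /Ap_dual /conj_exp.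
have -> : p / (p - 1) / p = (p - 1)^-1 by field; apply/andP; split; lra.
rewrite inver; case: ifP => _; last by rewrite poweR_EFin.
by rewrite poweRyr// invr_neq0//; lra.
Qed.

Lemma measurable_Ap_dual (p : R) (w : T -> R) (Q : set T) : 1 < p ->
  (forall x, 0 <= w x) -> measurable_fun setT w -> measurable_fun Q (Ap_dual p w).
Proof.
move=> p1 w0 mw; apply: measurable_funTS.
rewrite (_ : Ap_dual p w = fun x =>
    if w x == 0 then +oo%E else (((w x) `^ (-1)) `^ (p - 1)^-1)%:E); last first.
  by apply/funext => x; rewrite Ap_dualE// powR_inv1.
apply: measurable_fun_ifT => //; first exact: measurable_fun_eqr.
apply/measurable_EFinP/(measurableT_comp (measurable_powR _)).
exact: measurableT_comp (measurable_powR _) mw.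
Qed.

(** Let [s] be the mean over [Q] of the dual weight.  By Chebyshev the dual
    weight exceeds [8 s] on at most an eighth of [Q]; elsewhere
    [w >= (8 s) ^ (1 - p)].  A set with a quarter of the mass of [Q] therefore
    has weighted mass at least [(8 s) ^ (1 - p) * mu Q / 8], while the [A_p]
    condition says that [nu Q] is at most a multiple of [s ^ (1 - p) * mu Q]. *)
Lemma comparable_Ainfty (w : T -> R) : Ainfty mu w ->
  exists (nu : {measure set T -> \bar R}) (K : R),
    (nu : set T -> \bar R) = wmeasure mu w /\ comparable_measure mu nu K.
Proof.
move=> [p /= p1 [w0 [mw iw] dual_fin]].
set S := ereal_sup _ => Soo.
have [nu nuE] := wmeasure_is_measure w0 mw.
pose M := Num.max (fine S) 1.
have M0 : 0 < M by rewrite lt_max ltr01 orbT.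
have SM : (S <= M%:E)%E.
  case: S Soo @M {M0} => [s|//|] _ M /=; last by rewrite leNye.
  by rewrite lee_fin le_max lexx.
pose e := p - 1; have e0 : 0 < e by rewrite subr_gt0.
have nuS A : nu A = (\int[mu]_(x in A) (w x)%:E)%E by rewrite nuE.
have nu_fin Q : cubes Q -> nu Q \is a fin_num.
  by move=> cQ; rewrite nuS; apply: integrable_fin_num (iw Q cQ); exact: measurable_cubes.
pose K := 8 * 8 `^ e * M.
have K0 : 0 < K by rewrite !mulr_gt0// powR_gt0.
(* [b] is [(8 s) ^ (1 - p) / 8], with [s] the mean of the dual weight on [Q]. *)
have main Q : cubes Q -> exists b : R, [/\ 0 < b,
    (nu Q <= (K * b)%:E * mu Q)%E &
    forall F, measurable F -> F `<=` Q -> (mu Q <= 4%:E * mu F)%E ->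
      (b%:E * mu Q <= nu F)%E].
  move=> cQ; have mQ := measurable_cubes cQ.
  have finQ : mu Q \is a fin_num by exact: (fin_num_subset cube_mass cQ).
  have finw := nu_fin Q cQ.
  have Q0 : 0 < fine (mu Q) by have /andP[h1 h2] := cube_mass cQ; rewrite fine_gt0// h1.
  have md := @measurable_Ap_dual p w Q p1 w0 mw.
  have d0 x : (0 < Ap_dual p w x)%E.
    rewrite Ap_dualE//; case: eqVneq => // wx; rewrite lte_fin powR_gt0//.
    by rewrite invr_gt0 lt_neqAle eq_sym wx w0.
  have id0 : (0 <= \int[mu]_(x in Q) Ap_dual p w x)%E by apply: integral_ge0 => x _; exact: ltW.
  have finI : (\int[mu]_(x in Q) Ap_dual p w x)%E \is a fin_num.
    by rewrite ge0_fin_numE// dual_fin.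
  (* The dual weight is positive everywhere, as [w] is finite. *)
  have I0 : 0 < fine (\int[mu]_(x in Q) Ap_dual p w x)%E.
    rewrite lt_neqAle fine_ge0// andbT eq_sym; apply/eqP => I0.
    have : (\int[mu]_(x in Q) `|Ap_dual p w x| = 0)%E.
      rewrite -(fineK finI) I0 in id0 *.
      rewrite -[RHS]/(0%:E) -I0 fineK//; apply: eq_integral => x _.
      by rewrite gee0_abs// ltW.
    move/(ae_eq_integral_abs mu mQ md) => [N [mN N0 QN]].
    have /andP[+ _] := cube_mass cQ; rewrite ltNge => /negP; apply.
    rewrite -N0; apply: le_measure; rewrite ?inE//.
    by move=> x Qx; apply: QN => /= /(_ Qx) dx; have := d0 x; rewrite dx ltxx.
  set I := fine _ in I0; set m := fine _ in Q0.
  pose s := I / m; have s0 : 0 < s by rewrite divr_gt0.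
  pose lam := 8 * s; have lam0 : 0 < lam by rewrite mulr_gt0.
  have lame : lam `^ e = 8 `^ e * s `^ e by rewrite powRM// ltW.
  have le0 : 0 < lam `^ e by rewrite powR_gt0.
  have se0 : 0 < s `^ e by rewrite powR_gt0.
  exists ((lam `^ e)^-1 / 8); split.
  - by rewrite divr_gt0// invr_gt0.
  - have : (average mu Q (EFin \o w) * average mu Q (Ap_dual p w) `^ (p / conj_exp p) <= M%:E)%E.
      by apply: le_trans SM; apply: ereal_sup_ubound; exists Q.
    have -> : p / conj_exp p = e.
      by rewrite /conj_exp /e; field; apply/andP; split; lra.
    rewrite /average -nuS -(fineK finI) -(fineK finQ) -(fineK finw) -/I -/m.
    rewrite inver gt_eqF// -!EFinM [m^-1 * I]mulrC -/s !lee_fin.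
    have -> : K * ((lam `^ e)^-1 / 8) * m = M * (s `^ e)^-1 * m.
      rewrite /K lame; field; rewrite !gt_eqF// powR_gt0//.
    move=> h; rewrite -mulrA [_^-1 * m]mulrC mulrA ler_pdivlMr//.
    by rewrite -ler_pdivrMr// mulrAC [_ / m]mulrC.
  - move=> F mF FQ muF.
    have finF : mu F \is a fin_num by exact: (fin_num_subset cube_mass cQ).
    pose B := Q `&` [set x | w x < (lam `^ e)^-1].
    have mB : measurable B.
      have := mw measurableT _ (measurable_itv `]-oo, (lam `^ e)^-1[).
      by rewrite setTI => /(measurableI _ _ mQ); congr measurable;
        apply/seteqP; split => x [Qx] /=; rewrite in_itv.
    have BQ : B `<=` Q by move=> x [].
    have finB : mu B \is a fin_num by exact: (fin_num_subset cube_mass cQ).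
    have muB : (lam%:E * mu B <= I%:E)%E.
      rewrite fineK//; apply: (@le_trans _ _ (\int[mu]_(x in B) Ap_dual p w x)%E); last first.
        by apply: ge0_subset_integral => // x _; exact: ltW.
      rewrite -integral_cst//; apply: ge0_le_integral => //.
      + by move=> x _; rewrite lee_fin ltW.
      + exact: measurable_Ap_dual.
      move=> x [_ /= wx]; rewrite Ap_dualE//; case: eqVneq => [_|wx0]; first exact: leey.
      have wx1 : 0 < w x by rewrite lt_neqAle eq_sym wx0 w0.
      have -> : lam = (lam `^ e) `^ e^-1 by rewrite -powRrM mulfV ?gt_eqF// powRr1// ltW.
      rewrite lee_fin; apply: ge0_ler_powR; rewrite ?nnegrE ?invr_ge0 ?powR_ge0 ?(ltW e0)//.
      by rewrite -[leLHS]invrK lef_pV2 ?posrE ?invr_gt0// ltW.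
    have mFB : measurable (F `\` B) by exact: measurableD.
    have FBQ : F `\` B `<=` Q by move=> x [/FQ].
    have finFB : mu (F `\` B) \is a fin_num by exact: (fin_num_subset cube_mass cQ).
    have muFB : (mu F <= mu (F `\` B) + mu B)%E.
      apply: le_trans (measureU2 mu mFB mB).
      apply: le_measure; rewrite ?inE//; first exact: measurableU.
      by move=> x Fx; have [?|?] := pselect (B x); [right|left].
    have nuFB : (((lam `^ e)^-1)%:E * mu (F `\` B) <= nu F)%E.
      rewrite nuS; apply: (@le_trans _ _ (\int[mu]_(x in F `\` B) (w x)%:E)%E); last first.
        apply: ge0_subset_integral => //; first exact/measurable_EFinP/measurable_funTS.
        by move=> x _; rewrite lee_fin.
      rewrite -integral_cst//; apply: ge0_le_integral => //.
      + by move=> x _; rewrite lee_fin invr_ge0 ltW.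
      + exact/measurable_EFinP/measurable_funTS.
      move=> x [Fx nBx]; rewrite lee_fin leNgt; apply/negP => h; apply: nBx.
      by split => //; exact: FQ.
    apply: le_trans nuFB; rewrite EFinM -muleA; apply: lee_wpmul2l.
      by rewrite lee_fin invr_ge0 ltW.
    move: muF muFB muB; rewrite -(fineK finFB) -(fineK finF) -(fineK finQ) -(fineK finB) -/m.
    rewrite -!EFinM -!EFinD !lee_fin /lam => h1 h2.
    have -> : 8 * s * fine (mu B) = (8 * fine (mu B)) * s by ring.
    rewrite -ler_pdivlMr//; have -> : I / s = m by rewrite /s; field; rewrite !gt_eqF.
    lra.
exists nu, K; split => //; split => //.
- move=> Q cQ; have [b [b0 _ lo]] := main Q cQ; have mQ := measurable_cubes cQ.
  have /andP[Q0 _] := cube_mass cQ.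
  rewrite -ge0_fin_numE// nu_fin// andbT; apply: lt_le_trans (lo Q mQ _ _) => //.
    by rewrite mule_gt0// lte_fin.
  by rewrite lee_pemull// lee_fin; lra.
- move=> N mN N0; rewrite nuS; apply: null_set_integral => //.
  exact/measurable_EFinP/measurable_funTS.
- move=> Q F cQ mF FQ muF; have [b [b0 up lo]] := main Q cQ.
  apply: le_trans up _; rewrite EFinM -muleA; apply: lee_wpmul2l.
    by rewrite lee_fin ltW.
  exact: lo.
Qed.

End Weights.

(** * The two seminorms *)
Section Seminorms.
Context {R : realType} {n : nat}.
Local Notation T := (borelRn R n).

Lemma average_bound (nu : set T -> \bar R) (Q : set T) (g : T -> \bar R) (A : R) :
  (0 < nu Q < +oo)%E ->
  (average nu Q g <= A%:E)%E = (\int[nu]_(x in Q) g x <= A%:E * nu Q)%E.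
Proof.
move=> /andP[Q0 Qoo]; rewrite /average.
have finQ : nu Q \is a fin_num by rewrite ge0_fin_numE// ltW.
have q0 : 0 < fine (nu Q) by rewrite fine_gt0// Q0.
rewrite -(fineK finQ) inver gt_eqF// lee_pdivrMl//.
by rewrite muleC.
Qed.

Lemma poweR_inv_le (x : \bar R) (p A : R) : 0 < p -> 0 <= A -> (0 <= x)%E ->
  (x `^ p^-1 <= A%:E)%E = (x <= (A `^ p)%:E)%E.
Proof.
move=> p0 A0 x0; apply/idP/idP => h.
- have := @gt0_ler_poweR R p (ltW p0) (x `^ p^-1)%E A%:E.
  rewrite !in_itv/= !leey !andbT poweR_ge0 lee_fin A0 => /(_ isT isT h).
  by rewrite -poweRrM mulVf ?gt_eqF// poweRe1.
- have ip : 0 <= p^-1 by rewrite invr_ge0 ltW.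
  have := @gt0_ler_poweR R p^-1 ip x (A `^ p)%:E.
  rewrite !in_itv/= !leey !andbT x0 lee_fin powR_ge0 => /(_ isT isT h).
  by rewrite -powRrM mulfV ?gt_eqF// powRr1.
Qed.

Lemma BMO_norm_bound (nu : {measure set T -> \bar R}) f A :
  (forall Q, cubes Q -> (0 < nu Q < +oo)%E) -> 0 <= A ->
  (BMO_norm nu f <= A%:E)%E <-> Lp_bound nu 1 f A (cmean nu ^~ f).
Proof.
move=> nu_mass A0; rewrite Lp_bound1//; split=> [h Q cQ|h].
  rewrite -average_bound ?nu_mass//; apply: le_trans h.
  by apply: ereal_sup_ubound; exists Q.
by apply: ge_ereal_sup => _ [Q cQ <-]; rewrite average_bound ?nu_mass//; exact: h.
Qed.

Lemma wosc_bound (p : R) (mu : set T -> \bar R) (v w : T -> R)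
    (nw : {measure set T -> \bar R}) f A :
  0 < p -> 0 <= A -> (nw : set T -> \bar R) = wmeasure mu w ->
  (forall Q, cubes Q -> (0 < nw Q < +oo)%E) ->
  (wosc p mu v w f <= A%:E)%E <->
  Lp_bound nw p f A (cmean (wmeasure mu v) ^~ f).
Proof.
move=> p0 A0 nwE nw_mass; rewrite /wosc -nwE.
have cube_bound Q : cubes Q ->
    ((average nw Q (fun x => (cabs (f x - cmean (wmeasure mu v) Q f) `^ p)%:E)) `^ p^-1
       <= A%:E)%E =
    (\int[nw]_(x in Q) (cabs (f x - cmean (wmeasure mu v) Q f) `^ p)%:E
       <= (A `^ p)%:E * nw Q)%E.
  move=> cQ; have /andP[Q0 Qoo] := nw_mass Q cQ.
  rewrite poweR_inv_le//; first by rewrite average_bound// Q0.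
  rewrite mule_ge0 ?inve_ge0 ?(ltW Q0)//.
  by apply: integral_ge0 => x _; rewrite lee_fin powR_ge0.
split=> [h Q cQ|h].
  by rewrite -cube_bound//; apply: le_trans h; apply: ereal_sup_ubound; exists Q.
by apply: ge_ereal_sup => _ [Q cQ <-]; rewrite cube_bound//; exact: h.
Qed.

Lemma cube_exists : exists Q : set T, cubes Q.
Proof. by exists (cube 0 1), 0, 1. Qed.

End Seminorms.

(** The passage from implications between bounds, available for [A > 0] only,
    to a comparison of the seminorms; it covers the case [x = 0]. *)
Lemma scale_bound (R : realType) (x y : \bar R) (C : R) : 0 < C -> (0 <= x)%E ->
  (forall A : R, 0 < A -> (x <= A%:E)%E -> (y <= (C * A)%:E)%E) ->
  (y <= C%:E * x)%E.
Proof.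
move=> C0; case: x => [x||//] x0 h; last by rewrite gt0_muley ?lte_fin// leey.
apply/lee_addgt0Pr => e e0; rewrite -EFinM -EFinD.
have -> : C * x + e = C * (x + e / C) by field; rewrite gt_eqF.
have eC : 0 < e / C by rewrite divr_gt0.
by apply: h; [rewrite ltr_wpDl|rewrite lee_fin lerDl ltW].
Qed.

Lemma finite_bound (R : realType) (x : \bar R) : (x < +oo)%E ->
  exists2 A : R, 0 < A & (x <= A%:E)%E.
Proof.
case: x => [x|//|] _; last by exists 1; rewrite ?ltr01 ?leNye.
exists (Num.max x 1); first by rewrite lt_max ltr01 orbT.
by rewrite lee_fin le_max lexx.
Qed.

Unset Implicit Arguments.

Theorem theorem5p7 (R : realType) (n : nat)
  (mu : {measure set (borelRn R n) -> \bar R}) (p : R)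
  (v w : borelRn R n -> R) :
  (0 < n)%N ->
  radon_measure mu ->
  (forall Q, cubes Q -> (0 < mu Q < +oo)%E) ->
  (forall (i : 'I_n) (c : R), mu (coord_hyperplane i c) = 0%E) ->
  0 < p ->
  Ainfty mu v ->
  Ainfty mu w ->
  (forall f : borelRn R n -> R[i], cmeasurable f ->
     (L1loc (wmeasure mu v) f /\ (wosc p mu v w f < +oo)%E) <-> BMO mu f) /\
  (exists2 C : R, 0 < C &
     forall f : borelRn R n -> R[i], BMO mu f ->
       (BMO_norm mu f <= C%:E * wosc p mu v w f)%E /\
       (wosc p mu v w f <= C%:E * BMO_norm mu f)%E).
Proof.
move=> _ [_ outer _] mass hyper p0 Av Aw.
have [nv [Kv [nvE cv]]] := comparable_Ainfty mass Av.
have [nw [Kw [nwE cw]]] := comparable_Ainfty mass Aw.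
have cm : comparable_measure mu mu 4 by split => //; rewrite ltr0n.
have [_ nw_mass _ _] := cw.
have [D1 D10 h1] := Lp_bound_approx cm ltr01.
have [D2 D20 h2] := approx_cmean mass hyper outer cv.
have [D3 D30 h3] := approx_Lp_bound mass hyper outer cw p0.
have [E1 E10 g1] := Lp_bound_approx cw p0.
have [E2 E20 g2] := approx_cmean mass hyper outer cm.
have [E3 E30 g3] := approx_Lp_bound mass hyper outer cm ltr01.
pose C1 := D3 * (D2 * D1); pose C2 := E3 * (E2 * E1).
have C10 : 0 < C1 by rewrite !mulr_gt0.
have C20 : 0 < C2 by rewrite !mulr_gt0.
have toW f A : cmeasurable f -> 0 < A -> (BMO_norm mu f <= A%:E)%E ->
    L1loc (wmeasure mu v) f /\ (wosc p mu v w f <= (C1 * A)%:E)%E.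
  move=> mf A0 /(@BMO_norm_bound R n mu f _ mass (ltW A0)) /(h1 _ _ _ mf A0) a1.
  have DA : 0 < D1 * A by exact: mulr_gt0.
  have [fL a2] := h2 _ _ _ mf DA a1; rewrite -nvE; split=> //.
  have DDA : 0 < D2 * (D1 * A) by exact: mulr_gt0.
  have DDDA : 0 <= C1 * A by rewrite mulr_ge0 ?ltW.
  apply/(@wosc_bound R n p mu v w nw f _ p0 DDDA nwE nw_mass).
  by rewrite -nvE /C1 -!mulrA; exact: h3.
have toB f A : cmeasurable f -> 0 < A -> (wosc p mu v w f <= A%:E)%E ->
    L1loc mu f /\ (BMO_norm mu f <= (C2 * A)%:E)%E.
  move=> mf A0 /(@wosc_bound R n p mu v w nw f _ p0 (ltW A0) nwE nw_mass) /(g1 _ _ _ mf A0) a1.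
  have DA : 0 < E1 * A by exact: mulr_gt0.
  have [fL a2] := g2 _ _ _ mf DA a1; split=> //.
  have DDA : 0 < E2 * (E1 * A) by exact: mulr_gt0.
  have DDDA : 0 <= C2 * A by rewrite mulr_ge0 ?ltW.
  by apply/(@BMO_norm_bound R n mu f _ mass DDDA); rewrite /C2 -!mulrA; exact: g3.
have [Q0 cQ0] := @cube_exists R n.
have W0 f : (0 <= wosc p mu v w f)%E.
  apply: le_trans (poweR_ge0 _ _) (ereal_sup_ubound _); exists Q0 => //.
have B0 f : (0 <= BMO_norm mu f)%E.
  apply: le_trans (ereal_sup_ubound _); last by exists Q0.
  rewrite mule_ge0 ?inve_ge0//; apply: integral_ge0 => x _.
  by rewrite lee_fin cabs_ge0.
split=> [f mf|].
  split=> [[_ /finite_bound[A A0 hA]]|[_ /finite_bound[A A0 hA]]].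
    by have [fL hB] := toB f A mf A0 hA; split=> //; exact: le_lt_trans hB (ltry _).
  by have [fL hB] := toW f A mf A0 hA; split=> //; exact: le_lt_trans hB (ltry _).
exists (C1 + C2) => [|f [[mf _] _]]; first by rewrite addr_gt0.
split.
  apply: (@le_trans _ _ (C2%:E * wosc p mu v w f)%E).
    by apply: scale_bound => // A A0 hA; have [] := toB f A mf A0 hA.
  by apply: lee_wpmul2r => //; rewrite lee_fin lerDr ltW.
apply: (@le_trans _ _ (C1%:E * BMO_norm mu f)%E).
  by apply: scale_bound => // A A0 hA; have [] := toW f A mf A0 hA.
by apply: lee_wpmul2r => //; rewrite lee_fin lerDl ltW.
Qed.
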